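(* Let policies $\pi_\theta$ be represented by a function approximation with parameter $\theta$, in a discrete or continuous action space. For any meta-parameter $\phi$, let $\pi_{\theta'_\tau}=\mathcal Alg(\pi_\phi,\lambda,\tau)$, where $$\theta'_\tau=\operatorname*{argmax}_\theta\ \mathbb E_{s\sim\nu_\tau^{\pi_\phi},a\sim\pi_\phi(\cdot|s)}\Big[\frac{\pi_\theta(a|s)}{\pi_\phi(a|s)}Q_\tau^{\pi_\phi}(s,a)\Big]-\lambda\,\mathbb E_{s\sim\nu_\tau^{\pi_\phi}}\big[d^2(\pi_\phi(\cdot|s),\pi_\theta(\cdot|s))\big].$$ If $\nabla_\phi J_\tau(\pi_{\theta'_\tau})$ exists, then $$\nabla_\phi J_\tau(\pi_{\theta'_\tau})=\frac{1}{1-\gamma}\nabla_\phi\theta'_\tau\ \mathbb E_{s\sim\nu_\tau^{\pi_{\theta'_\tau}},a\sim\pi_{\theta'_\tau}(\cdot|s)}\Big[\frac{\nabla_{\theta'_\tau}\pi_{\theta'_\tau}(a|s)}{\pi_{\theta'_\tau}(a|s)}Q_\tau^{\pi_{\theta'_\tau}}(s,a)\Big],$$ and $$\nabla_\phi^\top\theta'_\tau=-\mathbb E_{s\sim\nu_\tau^{\pi_\phi},a\sim\pi_\phi(\cdot|s)}\Big[\nabla_\theta^2d^2(\pi_\phi(\cdot|s),\pi_\theta(\cdot|s))-\frac{\nabla_\theta^2\pi_\theta(a|s)}{\lambda\pi_\phi(a|s)}Q_\tau^{\pi_\phi}(s,a)\Big]^{-1}\ \mathbb E_{s\sim\nu_\tau^{\pi_\phi},a\sim\pi_\phi(\cdot|s)}\Big[\nabla_\phi^\top\nabla_\theta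 d^2(\pi_\phi(\cdot|s),\pi_\theta(\cdot|s))-\frac{\nabla_\theta\pi_\theta(a|s)}{\lambda\pi_\phi(a|s)}\nabla_\phi^\top Q_\tau^{\pi_\phi}(s,a)\Big]\Big|_{\theta=\theta'_\tau}.$$
   Context: The task $\tau$ is an MDP $(\mathcal S,\mathcal A,\gamma,\rho_\tau,P_\tau,r_\tau)$ with bounded state space, discrete or bounded continuous action space, discount $\gamma\in(0,1)$, initial distribution $\rho_\tau$, transition probability $P_\tau$ and reward $r_\tau$ with values in $[0,r_{max}]$. For a policy $\pi$, $V_\tau^\pi(s)=\mathbb E[\sum_{t\ge0}\gamma^tr_\tau(s_t,a_t,s_{t+1})|s_0=s,\pi]$, $Q_\tau^\pi(s,a)$ is the same with also $a_0=a$, $J_\tau(\pi)=\mathbb E_{s\sim\rho_\tau}[V_\tau^\pi(s)]$, and $\nu_\tau^\pi(s)=(1-\gamma)\sum_{t\ge0}\gamma^t\mathbb P(s_t=s|\pi,s_0\sim\rho_\tau)$. Here $d(\pi_\phi(\cdot|s),\pi_\theta(\cdot|s))$ is a chosen distance between two policies at state $s$ (e.g. $d^2$ equal to a KL divergence in either order, or $\|\phi-\theta\|^2$), and $\lambda>0$. $\nabla_\phi^\top g$ denotes the Jacobian of a vector-valued function $g$ of $\phi$ with rows indexed by components of $g$, and $\nabla_\phi\theta'_\tau$ is the transpose of $\nabla_\phi^\top\theta'_\tau$. In the formula for $\nabla_\phi^\top\theta'_\tau$, the inverse is the matrix inverse of the expectation.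
   Formalization: The formula for ∇_φ^⊤θ' is false in general: it omits the derivative through ν^{π_φ}. It is proved when that term vanishes. Also assumed: positive, smooth, dominated π_θ; smooth, locally bounded d²; invertible matrix; θ' continuous at φ. *)

(* Defs.v *)
From HB Require Import structures.
From mathcomp Require Import all_boot all_order all_algebra.
From mathcomp Require Import all_classical all_reals all_analysis.

Set Implicit Arguments.
Unset Strict Implicit.
Unset Printing Implicit Defensive.

Import Order.TTheory GRing.Theory Num.Theory.
Import numFieldNormedType.Exports.

Local Open Scope classical_set_scope.
Local Open Scope ring_scope.

(* The state and action spaces are arbitrary measurable types. *)
Record mdp (R : realType) (dS dA : measure_display)
    (S : measurableType dS) (A : measurableType dA) := Mdp {
  discount : R ;
  init : probability S R ;
  trans : R.-pker (S * A)%type ~> S ;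
  reward : S -> A -> S -> R ;
  rmax : R ;
  discount_gt0 : 0 < discount ;
  discount_lt1 : discount < 1 ;
  measurable_reward :
    measurable_fun [set: (S * A) * S] (fun x => reward x.1.1 x.1.2 x.2) ;
  reward_ge0 : forall s a s', 0 <= reward s a s' ;
  reward_le : forall s a s', reward s a s' <= rmax }.

Section markov_decision_process.
Context {R : realType} {dS dA : measure_display}.
Context {S : measurableType dS} {A : measurableType dA}.
(* [mu] is the reference measure for the values pi(a|s): the counting measure
   for discrete actions (pi(a|s) is then a probability mass), the Lebesgue
   measure on a bounded set for continuous ones (pi(a|s) is then a density). *)
Variable mu : {sigma_finite_measure set A -> \bar R}.
Variable M : mdp R S A.
Local Notation gamma := (discount M).

(* Strict positivity makes the importance ratio and the score meaningful. *)
Definition is_policy (p : S -> A -> R) : Prop :=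
  [/\ measurable_fun [set: S * A] (fun x => p x.1 x.2),
      forall s a, 0 < p s a &
      forall s, (\int[mu]_a (p s a)%:E = 1)%E].

(* pi(.|s) as a measure on actions *)
Definition action_law (p : S -> A -> R) (s : S) : set A -> \bar R :=
  fun C => (\int[mu]_(a in C) (p s a)%:E)%E.

(* The law of (s, a) when s has law [nu] and a ~ pi(.|s). *)
Definition sa_law (p : S -> A -> R) (nu : set S -> \bar R) :
    set (S * A) -> \bar R :=
  fun B => (\int[nu]_s action_law p s (xsection B s))%E.

(* The law of s' when (s, a) has law [eta] and s' ~ P(.|s, a). *)
Definition next_law (eta : set (S * A) -> \bar R) : set S -> \bar R :=
  fun B => (\int[eta]_x trans M x B)%E.

(* The law of (s_t, a_t) under the policy when (s_0, a_0) has law [eta]. *)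
Definition traj_law (p : S -> A -> R) (eta : set (S * A) -> \bar R) (t : nat) :
    set (S * A) -> \bar R :=
  iter t (fun eta' => sa_law p (next_law eta')) eta.

(* E[sum_t gamma^t r(s_t, a_t, s_{t+1})] when (s_0, a_0) has law [eta]. Rewards
   are nonnegative, so the expectation is taken term by term, each term under
   the law of (s_t, a_t, s_{t+1}). *)
Definition expected_return (p : S -> A -> R) (eta : set (S * A) -> \bar R) :
    R :=
  fine (\sum_(0 <= t <oo)
    (gamma ^+ t)%:E * \int[traj_law p eta t]_x
      \int[trans M x]_s' (reward M x.1 x.2 s')%:E)%E.

Definition value (p : S -> A -> R) (s : S) : R :=
  expected_return p (sa_law p (dirac s)).

Definition qvalue (p : S -> A -> R) (s : S) (a : A) : R :=
  expected_return p (dirac (s, a)).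

Definition performance (p : S -> A -> R) : R :=
  \int[init M]_s value p s.

(* P(s_t in B | pi, s_0 ~ rho) *)
Definition state_prob (p : S -> A -> R) (t : nat) (B : set S) : \bar R :=
  traj_law p (sa_law p (init M)) t (B `*` [set: A]).

(* The discounted visitation distribution, as a measure on states. *)
Definition visitation (p : S -> A -> R) : set S -> \bar R :=
  fun B => ((1 - gamma)%:E *
    \sum_(0 <= t <oo) (gamma ^+ t)%:E * state_prob p t B)%E.

(* The integrals are real-valued as in [Rintegral], which does not accept the
   unbundled measures above. *)
Definition expect_s (nu : set S -> \bar R) (f : S -> R) : R :=
  fine (\int[nu]_s (f s)%:E)%E.

Definition expect_a (p : S -> A -> R) (s : S) (f : A -> R) : R :=
  fine (\int[action_law p s]_a (f a)%:E)%E.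

(* E_{s ~ nu, a ~ p(.|s)}[f(s, a)], and its entrywise version for matrices *)
Definition expect_sa (nu : set S -> \bar R) (p : S -> A -> R)
    (f : S -> A -> R) : R :=
  expect_s nu (fun s => expect_a p s (f s)).

Definition expect_mx (k l : nat) (nu : set S -> \bar R) (p : S -> A -> R)
    (f : S -> A -> 'M[R]_(k, l)) : 'M[R]_(k, l) :=
  \matrix_(i, j) expect_sa nu p (fun s a => f s a i j).

End markov_decision_process.

Section gradients.
Context {R : realType} {n : nat}.

(* Parameters are row vectors, gradients are column vectors. *)
Definition grad (f : 'rV[R]_n -> R) (x : 'rV[R]_n) : 'cV[R]_n :=
  \col_i 'D_(delta_mx 0 i) f x.

(* nabla^T g: rows are indexed by the components of g, columns by those of the
   variable. *)
Definition nablaT (k : nat) (g : 'rV[R]_n -> 'cV[R]_k) (x : 'rV[R]_n) :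
    'M[R]_(k, n) :=
  \matrix_(i, j) 'D_(delta_mx 0 j) (fun y => g y i 0) x.

Definition hess (f : 'rV[R]_n -> R) (x : 'rV[R]_n) : 'M[R]_n :=
  nablaT (grad f) x.

(* nabla_phi^T nabla_theta f(phi, theta) *)
Definition mixed_hess (f : 'rV[R]_n -> 'rV[R]_n -> R) (phi theta : 'rV[R]_n) :
    'M[R]_n :=
  nablaT (fun psi => grad (f psi) theta) phi.

End gradients.

Section policy_adaptation.
Context {R : realType} {dS dA : measure_display}.
Context {S : measurableType dS} {A : measurableType dA}.
Variable mu : {sigma_finite_measure set A -> \bar R}.
Variable M : mdp R S A.
Variable n : nat.
Variable pi : 'rV[R]_n -> S -> A -> R.
(* [d s phi theta] is the distance between pi_phi(.|s) and pi_theta(.|s). It is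
   a function of the parameters, so as to include |phi - theta|. *)
Variable d : S -> 'rV[R]_n -> 'rV[R]_n -> R.
Variable lambda : R.

Definition adapt_objective (phi theta : 'rV[R]_n) : R :=
  expect_sa mu (visitation mu M (pi phi)) (pi phi)
    (fun s a => pi theta s a / pi phi s a * qvalue mu M (pi phi) s a)
  - lambda * expect_s (visitation mu M (pi phi))
               (fun s => d s phi theta ^+ 2).

(* theta' phi is a global maximizer (not assumed to be the only one). *)
Definition is_adaptation (theta' : 'rV[R]_n -> 'rV[R]_n) : Prop :=
  forall phi theta, adapt_objective phi theta <= adapt_objective phi (theta' phi).

(* Twice differentiable, with first and second derivatives dominated, locally
   uniformly in the parameter and uniformly in the state, by a function of the
   action. With finitely many actions, or with a bounded continuous action space
   and bounded derivatives, the function may be constant. *)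
Definition smooth_policies : Prop :=
  (forall theta s a, differentiable (fun t => pi t s a) theta) /\
  (forall theta s a i,
    differentiable (fun t => grad (fun t' => pi t' s a) t i 0) theta) /\
  (forall theta0 : 'rV[R]_n, exists h : A -> R,
    mu.-integrable [set: A] (EFin \o h) /\
    \forall theta \near theta0, forall s a,
      (forall i, `|grad (fun t => pi t s a) theta i 0| <= h a) /\
      (forall i j, `|hess (fun t => pi t s a) theta i j| <= h a)).

Definition distance_like : Prop :=
  (forall s phi theta, 0 <= d s phi theta) /\
  (forall s phi, d s phi phi = 0).

(* Smoothness is asked of d^2 only: d itself need not be differentiable when
   theta = phi. *)
Definition smooth_sqdistance : Prop :=
  (forall phi theta,
    measurable_fun [set: S] (fun s => d s phi theta ^+ 2)) /\
  (forall s phi theta, differentiable (fun t => d s phi t ^+ 2) theta) /\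
  (forall s i (x : 'rV[R]_n * 'rV[R]_n),
    differentiable (fun y : 'rV[R]_n * 'rV[R]_n =>
      grad (fun t => d s y.1 t ^+ 2) y.2 i 0) x) /\
  (forall x0 : 'rV[R]_n * 'rV[R]_n, exists C : R,
    \forall x \near x0, forall s,
      d s x.1 x.2 ^+ 2 <= C /\
      (forall i, `|grad (fun t => d s x.1 t ^+ 2) x.2 i 0| <= C) /\
      (forall i j, `|hess (fun t => d s x.1 t ^+ 2) x.2 i j| <= C) /\
      (forall i j, `|mixed_hess (fun f t => d s f t ^+ 2) x.1 x.2 i j| <= C)).

(* The matrix to be inverted. *)
Definition adapt_hess (phi theta : 'rV[R]_n) : 'M[R]_n :=
  expect_mx mu (visitation mu M (pi phi)) (pi phi) (fun s a =>
    hess (fun t => d s phi t ^+ 2) theta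
    - (qvalue mu M (pi phi) s a / (lambda * pi phi s a))
        *: hess (fun t => pi t s a) theta).

Definition adapt_cross (phi theta : 'rV[R]_n) : 'M[R]_n :=
  expect_mx mu (visitation mu M (pi phi)) (pi phi) (fun s a =>
    mixed_hess (fun f t => d s f t ^+ 2) phi theta
    - (lambda * pi phi s a)^-1
        *: (grad (fun t => pi t s a) theta
            *m (grad (fun f => qvalue mu M (pi f) s a) phi)^T)).

(* Differentiating the stationarity condition
     E_{s ~ nu^phi, a ~ pi_phi}[nabla_theta d^2
                                - nabla_theta pi_theta / (lambda pi_phi) Q] = 0
   in phi also produces the derivative of the state distribution nu^phi, the
   integrand being held fixed. This says that this term vanishes at phi, as it
   does when the stationarity condition holds state by state, or when the
   transitions do not depend on the actions. *)
Definition visitation_term_vanishes (phi theta : 'rV[R]_n) : Prop :=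
  nablaT (fun psi =>
    expect_mx mu (visitation mu M (pi psi)) (pi phi) (fun s a =>
      grad (fun t => d s phi t ^+ 2) theta
      - (qvalue mu M (pi phi) s a / (lambda * pi phi s a))
          *: grad (fun t => pi t s a) theta)) phi = 0.

End policy_adaptation.

(* Main.v *)
Require Import Defs.
From HB Require Import structures.
From mathcomp Require Import all_boot all_order all_algebra.
From mathcomp Require Import all_classical all_reals all_analysis.
From mathcomp Require Import measurable_realfun ring lra.

Set Implicit Arguments.
Unset Strict Implicit.
Unset Printing Implicit Defensive.

Import Order.TTheory GRing.Theory Num.Theory.
Import numFieldNormedType.Exports.

Local Open Scope classical_set_scope.
Local Open Scope ring_scope.

(* The resolvent structure of a discounted process turns everything into three
   identities: the Bellman equation for Q, the flow equation of the visitation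
   distribution nu^p, and, as a consequence of both, the performance difference
   formula
     (1 - gamma) (J(q) - J(p)) = E_{s ~ nu^p} [sum_a (q - p)(a|s) Q^q(s, a)].
   With the domination of the policy gradients, the last formula makes J
   Lipschitz, then Frechet differentiable, with the policy gradient as
   derivative. It holds for every initial distribution and every reward, so it
   also differentiates Q (start from the law of the next state) and the average
   of a bounded g under the visitation distribution (take g as reward).
   The stationarity condition F(phi, theta' phi) = 0 of the adaptation problem
   is then Frechet differentiable at (phi, theta' phi), with the partial
   differential in theta equal to the matrix to be inverted. Since theta' is
   continuous at phi, differentiability of F at that single point is enough for
   the implicit function argument, and the chain rule concludes. *)

(** The laws in the definitions ([sa_law], [next_law], [visitation]) are bare set functions given by
    iterated integrals, so theorems on measures do not apply to them directly. Each is therefore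
    matched with a positive functional satisfying monotone convergence; composing functionals
    replaces every disintegration argument, and a measure is rebuilt from the functional when one is
    required. The performance difference pairs the visitation of the old policy with the Q-function
    of the new one. The measure is then fixed while the parameter moves, and replacing the new Q by
    the old one costs a product of two Lipschitz increments, which is of second order. The
    stationarity map is treated the same way: measure and integrand are frozen in turn, with a
    second-order cross term. Q at each (s, a), and the average of each g, are performances of
    different processes, so the Lipschitz estimate must hold on one neighbourhood common to all of
    them. *)

Section positive_functionals.
Local Open Scope ereal_scope.
Context {d : measure_display} {T : measurableType d} {R : realType}.

Import HBNNSimple.

(** Daniell-style axioms for an integral on nonnegative functions, chosen to be stable under
    composition with kernels. *)
Record posfun (I : (T -> \bar R) -> \bar R) : Prop := Posfun {
  posfun_ge0 : forall f : T -> \bar R, (forall x, 0 <= f x) -> 0 <= I f ;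
  posfun_le : forall f g : T -> \bar R, (forall x, 0 <= f x) ->
    measurable_fun [set: T] f -> measurable_fun [set: T] g ->
    (forall x, f x <= g x) -> I f <= I g ;
  posfunD : forall f g : T -> \bar R, (forall x, 0 <= f x) -> (forall x, 0 <= g x) ->
    measurable_fun [set: T] f -> measurable_fun [set: T] g ->
    I (fun x => f x + g x) = I f + I g ;
  posfunZ : forall (c : R) (f : T -> \bar R), (0 <= c)%R -> (forall x, 0 <= f x) ->
    measurable_fun [set: T] f -> I (fun x => c%:E * f x) = c%:E * I f ;
  posfun_cvg : forall (f_ : nat -> T -> \bar R) (f : T -> \bar R),
    (forall n, measurable_fun [set: T] (f_ n)) -> (forall n x, 0 <= f_ n x) ->
    (forall x, nondecreasing_seq (f_ ^~ x)) ->
    (forall x, f_ ^~ x @ \oo --> f x) -> I (f_ n) @[n --> \oo] --> I f }.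

(** The integral is built from simple functions, whose level sets are measurable, so only values on
    measurable sets enter. A bare set function can thus be exchanged for a bundled measure under the
    integral. *)
Lemma integral_eq_measurable (m1 m2 : set T -> \bar R) (f : T -> \bar R) :
  (forall B, measurable B -> m1 B = m2 B) ->
  \int[m1]_x f x = \int[m2]_x f x.
Proof.
move=> m12; rewrite /integral; congr (ereal_sup _ - ereal_sup _);
  rewrite eqEsubset; split => _ [h hf <-]; exists h => //;
  by apply: eq_fsbigr => r _; rewrite m12//; exact: measurable_funPTI.
Qed.

Lemma posfun_integral (nu : {measure set T -> \bar R}) :
  posfun (fun f => \int[nu]_x f x).
Proof.
split.
- by move=> f f0; apply: integral_ge0 => x _.
- by move=> f g f0 mf mg fg; apply: ge0_le_integral => // x _; exact: fg.
- by move=> f g f0 g0 mf mg; rewrite ge0_integralD.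
- by move=> c f c0 f0 mf; rewrite ge0_integralZl_EFin.
- move=> f_ f mf f0 ndf ff.
  have -> : f = fun x => limn (f_ ^~ x).
    by apply/funext => x; apply/esym/cvg_lim => //; exact: ff.
  by apply: cvg_monotone_convergence => // x _; exact: ndf.
Qed.

Lemma posfun_sum (I : (T -> \bar R) -> \bar R) (PI : posfun I) (J : Type)
    (r : seq J) (f : J -> T -> \bar R) :
  (forall j x, 0 <= f j x) -> (forall j, measurable_fun [set: T] (f j)) ->
  I (fun x => \sum_(j <- r) f j x) = \sum_(j <- r) I (f j).
Proof.
move=> f0 mf; elim: r => [|j r ih].
  rewrite big_nil; under eq_fun do rewrite big_nil.
  (* [I] vanishes at the zero function by homogeneity with the scalar 0. *)
  have := posfunZ PI (lexx 0%R) (fun=> lexx _) (measurable_cst (0 : \bar R)).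
  by rewrite /cst !mul0e.
rewrite big_cons -ih -(posfunD PI)//.
- by congr I; apply/funext => x; rewrite big_cons.
- by move=> x; apply: sume_ge0 => k _.
- exact: emeasurable_sum.
Qed.

Lemma posfun_nneseries (I : (T -> \bar R) -> \bar R) (PI : posfun I)
    (f : nat -> T -> \bar R) :
  (forall n x, 0 <= f n x) -> (forall n, measurable_fun [set: T] (f n)) ->
  I (fun x => \sum_(0 <= n <oo) f n x) = \sum_(0 <= n <oo) I (f n).
Proof.
move=> f0 mf; apply/esym/cvg_lim => //.
under eq_fun do rewrite -(posfun_sum PI)//.
apply: (posfun_cvg PI) => /=.
- by move=> n; exact: emeasurable_sum.
- by move=> n x; exact: sume_ge0.
- by move=> x m n mn; exact: lee_sum_nneg_natr.
- by move=> x; exact: is_cvg_nneseries.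
Qed.

Section measure.
Variables (I : (T -> \bar R) -> \bar R) (PI : posfun I).

(** The proof of [posfun I] is an argument so that the measure structure declared below can be
    attached to this set function. *)
Definition posfun_measure_def of posfun I : set T -> \bar R :=
  fun B => I (fun x => (\1_B x)%:E).
Local Notation m := (posfun_measure_def PI).

Let m0 : m set0 = 0.
Proof.
have := @posfun_sum _ PI nat [::] (fun=> cst 0) (fun _ _ => lexx _)
  (fun _ => measurable_cst _).
rewrite big_nil /m => <-; congr I.
by apply/funext => x; rewrite big_nil indic0.
Qed.

Let m_ge0 B : 0 <= m B.
Proof. by apply: (posfun_ge0 PI) => x; rewrite lee_fin. Qed.

Let m_sigma_additive : semi_sigma_additive m.
Proof.
move=> F mF tF mUF; rewrite /m.
have mi B : measurable B -> measurable_fun [set: T] (fun x : T => (\1_B x : R)%:E).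
  by move=> mB; apply/measurable_EFinP; exact: measurable_indic.
have -> : (fun n => \sum_(0 <= i < n) I (fun x => (\1_(F i) x)%:E)) =
    (fun n => I (fun x => \sum_(0 <= i < n) (\1_(F i) x)%:E)).
  by apply/funext => n; rewrite -posfun_sum// => j; exact: mi.
apply: (posfun_cvg PI) => /=.
- by move=> n; apply: emeasurable_sum => k; exact: mi.
- by move=> n x; apply: sume_ge0.
- by move=> x a b ab; exact: lee_sum_nneg_natr.
- move=> x.
  (* At a fixed point, the series of indicators converges by sigma-additivity of the Dirac mass
     there. *)
  have := @measure_semi_sigma_additive _ _ _ (\d_x : {measure set T -> \bar R}) F mF tF mUF.
  exact.
Qed.

HB.instance Definition _ := isMeasure.Build d T R m m0 m_ge0 m_sigma_additive.

Definition posfun_measure : {measure set T -> \bar R} := m.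

(** Linearity gives the identity on simple functions; both sides pass to the increasing limit of the
    simple approximations of [f]. *)
Lemma integral_posfun_measure f : (forall x, 0 <= f x) ->
  measurable_fun [set: T] f -> \int[posfun_measure]_x f x = I f.
Proof.
have simple (h : {nnsfun T >-> R}) :
    \int[posfun_measure]_x (h x)%:E = I (EFin \o h).
  rewrite integralT_nnsfun sintegralE.
  rewrite fsbig_finite//=.
  transitivity (\sum_(r <- finmap.enum_fset (fset_set (range h)))
      I (fun x => r%:E * (\1_(h @^-1` [set r]) x)%:E)).
    rewrite big_seq [RHS]big_seq; apply: eq_bigr => r.
    rewrite in_fset_set// inE => -[x _ <-].
    rewrite (posfunZ PI)//; apply/measurable_EFinP; exact: measurable_indic.
  rewrite -(posfun_sum PI).
  - congr I; apply/funext => x /=.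
    by rewrite [in RHS]fimfunE -fsumEFin// fsbig_finite.
  - by move=> r x; exact: nnfun_muleindic_ge0.
  - move=> r; apply/measurable_EFinP/measurable_funM.
      exact: measurable_cst.
    by apply: measurable_indic; exact: measurable_funPTI.
move=> f0 mf; pose g := nnsfun_approx measurableT mf.
have gf x : (g n x)%:E @[n --> \oo] --> f x by exact: cvg_nnsfun_approx.
have mg n : measurable_fun [set: T] (EFin \o g n) by apply/measurable_EFinP.
have ndg x : nondecreasing_seq (fun n => (g n x)%:E).
  by move=> a b ab; rewrite lee_fin; exact/lefP/nd_nnsfun_approx.
have g0 n x : 0 <= (EFin \o g n) x by rewrite lee_fin.
have c1 := posfun_cvg PI mg g0 ndg gf.
have c2 := posfun_cvg (posfun_integral posfun_measure) mg g0 ndg gf.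
rewrite (_ : (fun n => _) = fun n => I (EFin \o g n)) in c2.
  exact: (cvg_unique _ c2 c1).
by apply/funext => n; exact: simple.
Qed.

End measure.

(* [m] need not be bundled as a measure: only its values on measurable sets
   matter. *)
Lemma integral_posfun (I : (T -> \bar R) -> \bar R) (m : set T -> \bar R) :
  posfun I ->
  (forall B, measurable B -> m B = I (fun x => (\1_B x)%:E)) ->
  forall f, (forall x, 0 <= f x) -> measurable_fun [set: T] f ->
  \int[m]_x f x = I f.
Proof.
move=> PI mI f f0 mf; rewrite -(integral_posfun_measure PI f0 mf).
by apply: integral_eq_measurable => B mB; exact: mI.
Qed.

End positive_functionals.

(** Functional form of composing a law with a kernel: each axiom is used for [K x] pointwise, then
    for [I]. *)
Lemma posfun_comp (R : realType) (d d' : measure_display)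
    (T : measurableType d) (U : measurableType d')
    (I : (T -> \bar R) -> \bar R) (K : T -> (U -> \bar R) -> \bar R) :
  posfun I -> (forall x, posfun (K x)) ->
  (forall f, (forall y, 0 <= f y)%E -> measurable_fun [set: U] f ->
    measurable_fun [set: T] (fun x => K x f)) ->
  posfun (fun f => I (fun x => K x f)).
Proof.
move=> PI PK mK; split.
- by move=> f f0; apply: (posfun_ge0 PI) => x; exact: (posfun_ge0 (PK x)).
- move=> f g f0 mf mg fg; apply: (posfun_le PI).
  + by move=> x; exact: (posfun_ge0 (PK x)).
  + exact: mK.
  + by apply: mK => // y; exact: le_trans (f0 y) (fg y).
  + by move=> x; exact: (posfun_le (PK x)).
- move=> f g f0 g0 mf mg; rewrite -(posfunD PI).
  + by congr I; apply/funext => x; rewrite (posfunD (PK x)).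
  + by move=> x; exact: (posfun_ge0 (PK x)).
  + by move=> x; exact: (posfun_ge0 (PK x)).
  + exact: mK.
  + exact: mK.
- move=> c f c0 f0 mf; rewrite -(posfunZ PI)//.
  + by congr I; apply/funext => x; rewrite (posfunZ (PK x)).
  + by move=> x; exact: (posfun_ge0 (PK x)).
  + exact: mK.
- move=> f_ f mf f0 ndf ff.
  apply: (posfun_cvg PI).
  + by move=> n; exact: mK.
  + by move=> n x; exact: (posfun_ge0 (PK x)).
  + move=> x a b ab.
    by apply: (posfun_le (PK x)) => // y; exact: ndf.
  + by move=> x; exact: (posfun_cvg (PK x)).
Qed.

Section posfun_constructions.
Local Open Scope ereal_scope.
Context {R : realType}.

Lemma posfun_eval (d : measure_display) (T : measurableType d) (x : T) :
  posfun (fun f : T -> \bar R => f x).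
Proof.
by split=> // f_ f _ _ _; exact.
Qed.

Lemma posfun_weighted (d : measure_display) (T : measurableType d)
    (mu : {measure set T -> \bar R}) (w : T -> R) :
  (forall x, 0 <= w x)%R -> measurable_fun [set: T] w ->
  posfun (fun f => \int[mu]_x ((w x)%:E * f x)).
Proof.
move=> w0 mw.
have mwf (f : T -> \bar R) : measurable_fun [set: T] f ->
    measurable_fun [set: T] (fun x => (w x)%:E * f x).
  by move=> mf; apply: emeasurable_funM => //; exact/measurable_EFinP.
have wf0 (f : T -> \bar R) : (forall x, 0 <= f x) ->
    forall x, 0 <= (w x)%:E * f x.
  by move=> f0 x; rewrite mule_ge0 ?lee_fin.
split.
- by move=> f f0; apply: integral_ge0 => x _; exact: wf0.
- move=> f g f0 mf mg fg; apply: ge0_le_integral => //.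
  + by move=> x _; exact: wf0.
  + exact: mwf.
  + exact: mwf.
  + by move=> x _; rewrite lee_wpmul2l ?lee_fin.
- move=> f g f0 g0 mf mg; rewrite -ge0_integralD//.
  + by apply: eq_integral => x _; rewrite ge0_muleDr.
  + by move=> x _; exact: wf0.
  + exact: mwf.
  + by move=> x _; exact: wf0.
  + exact: mwf.
- move=> c f c0 f0 mf; rewrite -ge0_integralZl_EFin//.
  + by apply: eq_integral => x _; rewrite muleCA.
  + by move=> x _; exact: wf0.
  + exact: mwf.
- move=> f_ f mf f0 ndf ff.
  apply: (posfun_cvg (posfun_integral mu)).
  + by move=> n; exact: mwf.
  + by move=> n x; exact: wf0.
  + by move=> x a b ab; rewrite lee_wpmul2l ?lee_fin// ndf.
  + by move=> x; apply: cvgeZl => //; exact: ff.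
Qed.

Lemma posfun_pullback (d d' : measure_display) (T : measurableType d)
    (U : measurableType d') (I : (T -> \bar R) -> \bar R) (phi : T -> U) :
  posfun I -> measurable_fun [set: T] phi ->
  posfun (fun f : U -> \bar R => I (f \o phi)).
Proof.
move=> PI mphi; apply: (posfun_comp (K := fun x f => f (phi x)) PI).
  by move=> x; exact: posfun_eval.
by move=> f f0 mf; exact: measurableT_comp.
Qed.

(** [I] is the integral that the bare set function [m] would have as a measure; carrying [I] along
    gives integrals against [m] a closed form. *)
Definition represents (d : measure_display) (T : measurableType d)
    (m : set T -> \bar R) (I : (T -> \bar R) -> \bar R) :=
  posfun I /\ forall B, measurable B -> m B = I (fun x => (\1_B x)%:E).

Lemma represents_integral (d : measure_display) (T : measurableType d)
    (m : set T -> \bar R) (I : (T -> \bar R) -> \bar R) (f : T -> \bar R) :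
  represents m I -> (forall x, 0 <= f x) -> measurable_fun [set: T] f ->
  \int[m]_x f x = I f.
Proof. by move=> [PI mI]; exact: integral_posfun. Qed.

End posfun_constructions.

(** * Bellman equations and visitation flow in the extended reals *)

Section decision_process.
Local Open Scope ereal_scope.
Context {R : realType} {dS dA : measure_display}.
Context {S : measurableType dS} {A : measurableType dA}.
Variables (mu : {sigma_finite_measure set A -> \bar R}) (M : mdp R S A).
Variables (p : S -> A -> R) (hp : is_policy mu p).
Local Notation gamma := (discount M).

Let mp : measurable_fun [set: S * A] (fun x => p x.1 x.2) := let: And3 h _ _ := hp in h.
Let p0 s a : (0 <= p s a)%R. Proof. by case: hp => _ + _ => /(_ s a)/ltW. Qed.
Let mps s : measurable_fun [set: A] (p s).
Proof. exact: (measurableT_comp mp (pair1_measurable s)). Qed.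

Definition act (f : S * A -> \bar R) (s : S) :=
  \int[mu]_a ((p s a)%:E * f (s, a)).

(** Transition operator of the state chain driven by [p], dual to one step of [state_law]. *)
Definition step (f : S -> \bar R) (s : S) :=
  act (fun x => \int[trans M x]_s' f s') s.

Definition mean_reward (x : S * A) : \bar R :=
  \int[trans M x]_s' (reward M x.1 x.2 s')%:E.

Definition state_law (nu : set S -> \bar R) (t : nat) : set S -> \bar R :=
  iter t (fun nu' => next_law M (sa_law mu p nu')) nu.

(** The Neumann series of gamma^t T^t r, with T the operator [step] and r the mean reward under [p]:
    the value function before finiteness is known, where sums and integrals may be exchanged
    freely. *)
Definition total_reward (s : S) : \bar R :=
  \sum_(0 <= t <oo) (gamma ^+ t)%:E * iter t step (act mean_reward) s.

Lemma measurable_act f : (forall x, 0 <= f x) ->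
  measurable_fun [set: S * A] f -> measurable_fun [set: S] (act f).
Proof.
move=> f0 mf; apply: (measurable_fun_fubini_tonelli_F
    (fun x : S * A => (p x.1 x.2)%:E * f x)).
  by apply: emeasurable_funM => //; exact/measurable_EFinP.
by move=> x; rewrite mule_ge0 ?lee_fin.
Qed.

Lemma posfun_act s : posfun (act ^~ s).
Proof.
apply: (posfun_pullback (phi := fun a => (s, a)) (posfun_weighted mu (p0 s) (mps s))).
exact: pair1_measurable.
Qed.

Lemma measurable_trans (f : S -> \bar R) : (forall x, 0 <= f x) ->
  measurable_fun [set: S] f ->
  measurable_fun [set: S * A] (fun x => \int[trans M x]_s' f s').
Proof.
move=> f0 mf; apply: measurable_fun_integral_kernel => // U mU.
exact: measurable_kernel.
Qed.

Lemma measurable_step f : (forall x, 0 <= f x) ->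
  measurable_fun [set: S] f -> measurable_fun [set: S] (step f).
Proof.
move=> f0 mf; apply: measurable_act; last exact: measurable_trans.
by move=> x; apply: integral_ge0 => s _.
Qed.

Lemma posfun_step s : posfun (step ^~ s).
Proof.
apply: (posfun_comp (posfun_act s)).
  by move=> x; exact: posfun_integral.
exact: measurable_trans.
Qed.

Lemma step_ge0 f : (forall x, 0 <= f x) -> forall s, 0 <= step f s.
Proof. by move=> f0 s; exact: (posfun_ge0 (posfun_step s)). Qed.

Lemma iter_step_ge0 t f : (forall x, 0 <= f x) -> forall s, 0 <= iter t step f s.
Proof. by move=> f0; elim: t => // t ih s; exact: step_ge0. Qed.

Lemma measurable_iter_step t f : (forall x, 0 <= f x) ->
  measurable_fun [set: S] f -> measurable_fun [set: S] (iter t step f).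
Proof.
move=> f0 mf; elim: t => // t ih; apply: measurable_step => //.
exact: iter_step_ge0.
Qed.

Lemma action_law_indic s (B : set A) : measurable B ->
  action_law mu p s B = \int[mu]_a ((p s a)%:E * (\1_B a)%:E).
Proof. by move=> mB; rewrite /action_law integral_mkcond epatch_indic. Qed.

Lemma represents_action_law s :
  represents (action_law mu p s) (fun f => \int[mu]_a ((p s a)%:E * f a)).
Proof.
by split; [exact: posfun_weighted | exact: action_law_indic].
Qed.

Lemma act_indic s (B : set (S * A)) : measurable B ->
  act (fun x => (\1_B x)%:E) s = action_law mu p s (xsection B s).
Proof.
move=> mB; rewrite action_law_indic; last exact: measurable_xsection.
by apply: eq_integral => a _; rewrite !indicE mem_xsection.
Qed.

Lemma represents_sa_law nu I : represents nu I ->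
  represents (sa_law mu p nu) (fun f => I (act f)).
Proof.
move=> nuI; have [PI _] := nuI; have PK : posfun (fun f => I (act f)).
  exact: (posfun_comp PI posfun_act measurable_act).
split => // B mB.
have mi : measurable_fun [set: S * A] (fun x => (\1_B x)%:E : \bar R).
  by apply/measurable_EFinP; exact: measurable_indic.
have -> : sa_law mu p nu B = \int[nu]_s act (fun x => (\1_B x)%:E) s.
  by congr (integral _ _ _); apply/funext => s; rewrite act_indic.
rewrite (represents_integral nuI)//.
- by move=> s; apply: (posfun_ge0 (posfun_act s)) => x; rewrite lee_fin.
- by apply: measurable_act => // x; rewrite lee_fin.
Qed.

Lemma represents_next_law eta I : represents eta I ->
  represents (next_law M eta) (fun f => I (fun x => \int[trans M x]_s' f s')).
Proof.
move=> nuI; have [PI _] := nuI; have PK : posfun (fun f => I (fun x => \int[trans M x]_s' f s')).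
  apply: (posfun_comp PI (fun x => posfun_integral (trans M x))).
  exact: measurable_trans.
split => // B mB.
have -> : next_law M eta B = \int[eta]_x \int[trans M x]_s' (\1_B s')%:E.
  congr (integral _ _ _); apply/funext => x.
  by rewrite integral_indic// setIT.
rewrite (represents_integral nuI)//.
- by move=> x; apply: integral_ge0 => s _; rewrite lee_fin.
- apply: measurable_trans => [x|]; first by rewrite lee_fin.
  by apply/measurable_EFinP; exact: measurable_indic.
Qed.

(** Duality: pushing the law forward [t] times amounts to applying the operator [t] times to the
    test function. The last transition acts first on that function, hence [iterSr]. *)
Lemma represents_state_law nu I t : represents nu I ->
  represents (state_law nu t) (fun f => I (iter t step f)).
Proof.
move=> nuI; elim: t => // t ih.
have := represents_next_law (represents_sa_law ih).
by under eq_fun do rewrite -iterSr.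
Qed.

Lemma traj_law_sa nu t :
  traj_law mu M p (sa_law mu p nu) t = sa_law mu p (state_law nu t).
Proof. by elim: t => // t; rewrite /traj_law !iterS => ->. Qed.

(** After one transition the trajectory is that of the state chain started at the next state, with
    the action drawn last. *)
Lemma traj_lawS eta t :
  traj_law mu M p eta t.+1 = sa_law mu p (state_law (next_law M eta) t).
Proof. by rewrite -traj_law_sa /traj_law iterSr. Qed.

(** Serves to see that the terms of the return series are nonnegative, for which any representing
    functional will do. *)
Lemma traj_law_represented eta I t : represents eta I ->
  exists J, represents (traj_law mu M p eta t) J.
Proof.
move=> etaI; elim: t => [|t [J ih]]; first by exists I.
by eexists; exact: (represents_sa_law (represents_next_law ih)).
Qed.

Lemma mean_reward_ge0 x : 0 <= mean_reward x.
Proof. by apply: integral_ge0 => s _; rewrite lee_fin; exact: reward_ge0. Qed.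

Lemma measurable_mean_reward : measurable_fun [set: S * A] mean_reward.
Proof.
apply: (measurable_fun_integral_sfinite_kernel
  (fun y : (S * A) * S => (reward M y.1.1 y.1.2 y.2)%:E) (trans M)).
  by move=> y; rewrite lee_fin; exact: reward_ge0.
by apply/measurable_EFinP; exact: measurable_reward.
Qed.

Lemma act_reward_ge0 s : 0 <= act mean_reward s.
Proof. by apply: (posfun_ge0 (posfun_act s)) => x; exact: mean_reward_ge0. Qed.

Lemma measurable_act_reward : measurable_fun [set: S] (act mean_reward).
Proof.
by apply: measurable_act; [exact: mean_reward_ge0 | exact: measurable_mean_reward].
Qed.

Let gammaX_ge0 t : (0 <= gamma ^+ t)%R.
Proof. by apply: exprn_ge0; apply: ltW; exact: discount_gt0. Qed.

Lemma measurable_discounted_step f : (forall x, 0 <= f x) ->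
  measurable_fun [set: S] f -> forall t,
  measurable_fun [set: S] (fun s => (gamma ^+ t)%:E * iter t step f s).
Proof.
by move=> f0 mf t; apply: measurable_funeM; exact: measurable_iter_step.
Qed.

Lemma discounted_step_ge0 f : (forall x, 0 <= f x) -> forall t s,
  0 <= (gamma ^+ t)%:E * iter t step f s.
Proof. by move=> f0 t s; rewrite mule_ge0 ?lee_fin// iter_step_ge0. Qed.

Lemma posfun_discounted I f : posfun I -> (forall x, 0 <= f x) ->
  measurable_fun [set: S] f ->
  \sum_(0 <= t <oo) (gamma ^+ t)%:E * I (iter t step f) =
  I (fun s => \sum_(0 <= t <oo) (gamma ^+ t)%:E * iter t step f s).
Proof.
move=> PI f0 mf; rewrite (posfun_nneseries PI).
- apply: eq_eseriesr => t _; rewrite (posfunZ PI)//.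
    exact: iter_step_ge0.
  exact: measurable_iter_step.
- exact: discounted_step_ge0.
- exact: measurable_discounted_step.
Qed.

Lemma expected_return_sa nu I : represents nu I ->
  expected_return mu M p (sa_law mu p nu) = fine (I total_reward).
Proof.
move=> nuI; have [PI _] := nuI.
rewrite /expected_return -(posfun_discounted PI act_reward_ge0 measurable_act_reward).
congr fine; apply: eq_eseriesr => t _; rewrite traj_law_sa.
rewrite (represents_integral (represents_sa_law (represents_state_law t nuI)))//.
  exact: mean_reward_ge0.
exact: measurable_mean_reward.
Qed.

Lemma represents_dirac (d : measure_display) (T : measurableType d) (x : T) :
  represents (dirac x : set T -> \bar R) (fun f => f x).
Proof.
by split; first exact: posfun_eval.
Qed.

Lemma valueE s : value mu M p s = fine (total_reward s).
Proof. exact: expected_return_sa (represents_dirac s). Qed.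

(** The term t = 0 is the immediate reward; the tail, reindexed by one, is gamma times the return of
    the chain restarted from the next state. *)
Lemma qvalueE s a : qvalue mu M p s a =
  fine (mean_reward (s, a) + gamma%:E * \int[trans M (s, a)]_s' total_reward s').
Proof.
have hx := represents_dirac (s, a).
have hn := represents_next_law hx; have [Pn _] := hn.
have traj_ge0 t : 0 <= (gamma ^+ t)%:E *
    \int[traj_law mu M p (dirac (s, a)) t]_x mean_reward x.
  apply: mule_ge0; first by rewrite lee_fin.
  have [J hJ] := traj_law_represented t hx; rewrite (represents_integral hJ).
  - by case: hJ => PJ _; apply: (posfun_ge0 PJ); exact: mean_reward_ge0.
  - exact: mean_reward_ge0.
  - exact: measurable_mean_reward.
rewrite /qvalue /expected_return nneseries_recl//.
rewrite expr0 mul1e.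
rewrite [X in X + _](represents_integral hx mean_reward_ge0 measurable_mean_reward).
congr (fine (_ + _)).
rewrite -(posfun_discounted Pn act_reward_ge0 measurable_act_reward).
rewrite -nneseriesZl; last first.
  move=> t _; rewrite mule_ge0 ?lee_fin//; apply: (posfun_ge0 Pn).
  by apply: iter_step_ge0; exact: act_reward_ge0.
rewrite -(@nneseries_addn _ _ 1); last exact: traj_ge0.
apply: eq_eseriesr => t _; rewrite addn1 traj_lawS exprS EFinM -muleA.
rewrite (represents_integral (represents_sa_law (represents_state_law t hn)))//.
  exact: mean_reward_ge0.
exact: measurable_mean_reward.
Qed.

Lemma total_reward_ge0 s : 0 <= total_reward s.
Proof.
by apply: nneseries_ge0 => t _ _; exact: discounted_step_ge0 act_reward_ge0 _ _.
Qed.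

Lemma measurable_total_reward : measurable_fun [set: S] total_reward.
Proof.
apply: ge0_emeasurable_sum => [t x _ _|t _].
  exact: discounted_step_ge0 act_reward_ge0 _ _.
exact: measurable_discounted_step act_reward_ge0 measurable_act_reward t.
Qed.

Lemma act_cst s (c : R) : (0 <= c)%R -> act (cst c%:E) s = c%:E.
Proof.
move=> c0; case: hp => _ _ /(_ s) p1; rewrite /act /cst.
under eq_integral do rewrite muleC.
rewrite ge0_integralZl_EFin ?p1 ?mule1//.
  by move=> a _; rewrite lee_fin.
exact/measurable_EFinP.
Qed.

Lemma act_le f s (c : R) : (0 <= c)%R -> (forall x, 0 <= f x) ->
  measurable_fun [set: S * A] f -> (forall x, f x <= c%:E) -> act f s <= c%:E.
Proof.
move=> c0 f0 mf fc; rewrite -(act_cst s c0).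
by apply: (posfun_le (posfun_act s)) => // x; exact: fc.
Qed.

Lemma trans_le x f (c : R) : (forall s, 0 <= f s) -> measurable_fun [set: S] f ->
  (forall s, f s <= c%:E) -> \int[trans M x]_s f s <= c%:E.
Proof.
move=> f0 mf fc; apply: (@le_trans _ _ (\int[trans M x]_s (cst c%:E s))).
  by apply: ge0_le_integral => // s _; exact: fc.
by rewrite integral_cst// prob_kernel mule1.
Qed.

Lemma step_le f (c : R) : (0 <= c)%R -> (forall s, 0 <= f s) -> measurable_fun [set: S] f ->
  (forall s, f s <= c%:E) -> forall s, step f s <= c%:E.
Proof.
move=> c0 f0 mf fc s; apply: act_le => //.
- by move=> x; apply: integral_ge0 => ? _.
- exact: measurable_trans.
- by move=> x; exact: trans_le.
Qed.

Lemma mean_reward_le x : mean_reward x <= `|rmax M|%:E.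
Proof.
apply: trans_le => [s||s].
- by rewrite lee_fin reward_ge0.
- apply/measurable_EFinP.
  exact: (measurableT_comp (measurable_reward M) (pair1_measurable x)).
- by rewrite lee_fin (le_trans (reward_le M _ _ _))// ler_norm.
Qed.

Lemma iter_step_reward_le t s : iter t step (act mean_reward) s <= `|rmax M|%:E.
Proof.
elim: t s => [|t ih] s /=.
  by apply: act_le; [by []|exact: mean_reward_ge0|exact: measurable_mean_reward|
    exact: mean_reward_le].
apply: step_le => //.
- exact: iter_step_ge0 act_reward_ge0.
- exact: measurable_iter_step act_reward_ge0 measurable_act_reward.
Qed.

Lemma discounted_cst (c : R) :
  \sum_(0 <= t <oo) ((gamma ^+ t)%:E * c%:E) = (c / (1 - gamma))%:E.
Proof.
have g1 : (`|gamma| < 1)%R.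
  by rewrite ger0_norm ?discount_lt1// ltW// discount_gt0.
apply/cvg_lim => //; rewrite (_ : (fun n => _) = EFin \o series (geometric c gamma)).
  by apply/fine_cvgP; split; [exact: nearW|exact: cvg_geometric_series].
apply/funext => n /=; rewrite /series/= -sumEFin.
by apply: eq_bigr => i _; rewrite muleC.
Qed.

(** Sum of the geometric series. The absolute value makes the bound nonnegative with no appeal to an
    existing state and action, which a proof of 0 <= rmax would require. *)
Definition value_bound := (`|rmax M| / (1 - gamma))%R.

Lemma total_reward_le s : total_reward s <= value_bound%:E.
Proof.
rewrite -discounted_cst; apply: lee_nneseries => [t _ _|t _].
  exact: discounted_step_ge0 act_reward_ge0 _ _.
by rewrite lee_wpmul2l ?lee_fin//; exact: iter_step_reward_le.
Qed.

Lemma total_reward_value s : total_reward s = (value mu M p s)%:E.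
Proof.
rewrite valueE fineK// ge0_fin_numE ?total_reward_ge0//.
by rewrite (le_lt_trans (total_reward_le s))// ltry.
Qed.

Lemma value_ge0 s : (0 <= value mu M p s)%R.
Proof. by rewrite -lee_fin -total_reward_value total_reward_ge0. Qed.

Lemma value_le s : (value mu M p s <= value_bound)%R.
Proof. by rewrite -lee_fin -total_reward_value total_reward_le. Qed.

Lemma measurable_value : measurable_fun [set: S] (value mu M p).
Proof.
apply/measurable_EFinP; rewrite (_ : _ \o _ = total_reward).
  exact: measurable_total_reward.
by apply/funext => s /=; rewrite total_reward_value.
Qed.

Lemma bellman_qvalue s a : (qvalue mu M p s a)%:E =
  mean_reward (s, a) + gamma%:E * \int[trans M (s, a)]_s' (value mu M p s')%:E.
Proof.
have e : \int[trans M (s, a)]_s' total_reward s' =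
    \int[trans M (s, a)]_s' (value mu M p s')%:E.
  by apply: eq_integral => s' _; exact: total_reward_value.
rewrite qvalueE e fineK// fin_numD; apply/andP; split.
  rewrite ge0_fin_numE ?mean_reward_ge0//.
  by rewrite (le_lt_trans (mean_reward_le _))// ltry.
rewrite fin_numM// ge0_fin_numE; last first.
  by apply: integral_ge0 => s' _; rewrite lee_fin value_ge0.
apply: (@le_lt_trans _ _ value_bound%:E); last exact: ltry.
apply: trans_le => [s'||s'].
- by rewrite lee_fin value_ge0.
- by apply/measurable_EFinP; exact: measurable_value.
- by rewrite lee_fin value_le.
Qed.

Lemma qvalue_ge0 s a : (0 <= qvalue mu M p s a)%R.
Proof.
rewrite -lee_fin bellman_qvalue adde_ge0 ?mean_reward_ge0// mule_ge0//.
  by rewrite lee_fin ltW// discount_gt0.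
by apply: integral_ge0 => s' _; rewrite lee_fin value_ge0.
Qed.

Lemma qvalue_le s a : (qvalue mu M p s a <= value_bound)%R.
Proof.
(* The bound is the fixed point of c |-> |rmax| + gamma c, hence stable under one Bellman step. *)
have h : value_bound = (`|rmax M| + gamma * value_bound)%R.
  have : (1 - gamma != 0)%R by rewrite subr_eq0 eq_sym lt_eqF// discount_lt1.
  by rewrite /value_bound => ?; field.
rewrite -lee_fin bellman_qvalue h EFinD EFinM leeD ?mean_reward_le//.
apply: lee_wpmul2l; first by rewrite lee_fin ltW// discount_gt0.
apply: trans_le => [s'||s'].
- by rewrite lee_fin value_ge0.
- by apply/measurable_EFinP; exact: measurable_value.
- by rewrite lee_fin value_le.
Qed.

Lemma measurable_qvalue :
  measurable_fun [set: S * A] (fun x => qvalue mu M p x.1 x.2).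
Proof.
apply/measurable_EFinP.
rewrite (_ : _ \o _ = fun x => mean_reward x +
    gamma%:E * \int[trans M x]_s' (value mu M p s')%:E); last first.
  by apply/funext => -[s a] /=; rewrite bellman_qvalue.
apply: emeasurable_funD; first exact: measurable_mean_reward.
apply: measurable_funeM; apply: measurable_trans => [s|].
  by rewrite lee_fin value_ge0.
by apply/measurable_EFinP; exact: measurable_value.
Qed.

(** Splitting off t = 0 leaves gamma times one [step] of the whole series. Both pieces are action
    averages, and additivity of [act] merges them into the average of the Bellman expression of
    Q. *)
Lemma bellman_value s : (value mu M p s)%:E =
  \int[mu]_a ((p s a)%:E * (qvalue mu M p s a)%:E).
Proof.
rewrite -total_reward_value /total_reward nneseries_recl//; last first.
  by move=> t _; exact: discounted_step_ge0 act_reward_ge0 _ _.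
rewrite -(@nneseries_addn _ _ 1); last first.
  by move=> t; exact: discounted_step_ge0 act_reward_ge0 _ _.
have -> : \sum_(0 <= t <oo) ((gamma ^+ (t + 1))%:E *
    iter (t + 1) step (act mean_reward) s) = gamma%:E * step total_reward s.
  rewrite -(posfun_discounted (posfun_step s) act_reward_ge0 measurable_act_reward).
  rewrite -nneseriesZl; last first.
    move=> t _; rewrite mule_ge0 ?lee_fin//; apply: step_ge0.
    exact: iter_step_ge0 act_reward_ge0.
  by apply: eq_eseriesr => t _; rewrite addn1 exprS EFinM -muleA.
have m1 : measurable_fun [set: S * A] (fun x => \int[trans M x]_s' total_reward s').
  exact: measurable_trans total_reward_ge0 measurable_total_reward.
have m0 x : 0 <= \int[trans M x]_s' total_reward s'.
  by apply: integral_ge0 => s' _; exact: total_reward_ge0.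
have g0 : (0 <= gamma)%R by rewrite ltW// discount_gt0.
rewrite expr0 mul1e -(posfunZ (posfun_act s))//.
rewrite -(posfunD (posfun_act s))//.
- apply: eq_integral => a _; rewrite bellman_qvalue; congr (_ * (_ + _ * _)).
  by apply: eq_integral => s' _; exact: total_reward_value.
- exact: mean_reward_ge0.
- by move=> x; rewrite mule_ge0.
- exact: measurable_mean_reward.
- exact: measurable_funeM.
Qed.

Let posfun_init_step t : posfun (fun f => \int[init M]_s iter t step f s).
Proof.
have hi : represents (init M : set S -> \bar R) (fun f => \int[init M]_s f s).
  by split=> [|B mB]; [exact: posfun_integral | rewrite integral_indic// setIT].
by have [] := represents_state_law t hi.
Qed.

Lemma performance_value : (performance mu M p)%:E =
  \int[init M]_s (value mu M p s)%:E.
Proof.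
rewrite /performance /Rintegral fineK// ge0_fin_numE; last first.
  by apply: integral_ge0 => s _; rewrite lee_fin value_ge0.
apply: (@le_lt_trans _ _ (\int[init M]_s (cst value_bound%:E s))).
  apply: ge0_le_integral => //.
  - by move=> s _; rewrite lee_fin value_ge0.
  - by apply/measurable_EFinP; exact: measurable_value.
  - by move=> s _; rewrite lee_fin value_le.
by rewrite integral_cst// [X in _ * X](probability_setT (init M)) mule1 ltry.
Qed.

Lemma act_fst f s : (forall x, 0 <= f x) -> act (fun x => f x.1) s = f s.
Proof.
move=> f0; case: hp => _ _ /(_ s) p1; rewrite /act/=.
by rewrite ge0_integralZr// ?p1 ?mul1e//; [exact/measurable_EFinP|move=> a _; rewrite lee_fin].
Qed.

Lemma state_probE t (B : set S) : measurable B ->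
  state_prob mu M p t B = \int[init M]_s iter t step (fun s => (\1_B s)%:E) s.
Proof.
move=> mB; have hi : represents (init M : set S -> \bar R) (fun f => \int[init M]_s f s).
  by split=> [|C mC]; [exact: posfun_integral | rewrite integral_indic// setIT].
rewrite /state_prob traj_law_sa.
have [_ ->] := represents_sa_law (represents_state_law t hi); last exact: measurableX.
congr (integral _ _ _); congr (iter t step _); apply/funext => s.
rewrite -(act_fst s (f := fun s => (\1_B s)%:E)) => [|x]; last by rewrite lee_fin.
by congr (act _ s); apply/funext => x; rewrite !indicE in_setX in_setT andbT.
Qed.

Let discount_nng t : {nonneg R} := NngNum (gammaX_ge0 t).
Let onem_discount_ge0 : (0 <= 1 - gamma)%R.
Proof. by rewrite subr_ge0 ltW// discount_lt1. Qed.

(** Bundled counterpart of [visitation]: the law of each s_t is rebuilt from its functional, then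
    weighted and summed. *)
Definition visitation_measure : {measure set S -> \bar R} :=
  mscale (NngNum onem_discount_ge0)
    (mseries (fun t => mscale (discount_nng t) (posfun_measure (posfun_init_step t))) 0).

Lemma visitation_measureE (B : set S) : measurable B ->
  visitation mu M p B = visitation_measure B.
Proof.
move=> mB; rewrite /visitation /visitation_measure /= /mscale /=; congr (_ * _).
by rewrite /mseries; apply: eq_eseriesr => t _; rewrite state_probE.
Qed.

Lemma integral_visitation_measure f : (forall x, 0 <= f x) ->
  measurable_fun [set: S] f ->
  \int[visitation_measure]_s f s =
  (1 - gamma)%:E *
  \sum_(0 <= t <oo) (gamma ^+ t)%:E * \int[init M]_s iter t step f s.
Proof.
move=> f0 mf; rewrite ge0_integral_mscale// ge0_integral_measure_series//.
congr (_ * _); apply: eq_eseriesr => t _.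
by rewrite ge0_integral_mscale// integral_posfun_measure.
Qed.

Lemma visitation_measureT : visitation_measure [set: S] = 1.
Proof.
transitivity (\int[visitation_measure]_s (cst 1 s)).
  by rewrite integral_cst// mul1e.
rewrite integral_visitation_measure//.
have st t : iter t step (cst 1) = cst 1.
  elim: t => // t /= ->; apply/funext => s; rewrite /step.
  rewrite -[RHS](act_cst s ler01); congr act; apply/funext => x /=.
  by rewrite integral_cst// prob_kernel mule1.
have int1 t : \int[init M]_s iter t step (cst 1) s = 1.
  by rewrite st integral_cst// mul1e; exact: probability_setT.
under eq_eseriesr do rewrite int1.
rewrite discounted_cst -EFinM mul1r mulfV//.
by rewrite subr_eq0 eq_sym lt_eqF// discount_lt1.
Qed.

(** Weak form of nu = (1 - gamma) rho + gamma nu T, with T the operator [step]: peel off t = 0; the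
    remaining series is the one for [step f]. *)
Lemma visitation_flow f : (forall x, 0 <= f x) -> measurable_fun [set: S] f ->
  \int[visitation_measure]_s f s = (1 - gamma)%:E * \int[init M]_s f s +
    gamma%:E * \int[visitation_measure]_s step f s.
Proof.
move=> f0 mf.
have term0 t : 0 <= (gamma ^+ t)%:E * \int[init M]_s iter t step f s.
  by rewrite mule_ge0 ?lee_fin//; apply: integral_ge0 => s _; exact: iter_step_ge0.
rewrite !integral_visitation_measure//; last 2 first.
- exact: step_ge0.
- exact: measurable_step.
rewrite nneseries_recl// -(@nneseries_addn _ _ 1)// expr0 mul1e.
rewrite ge0_muleDr//; last 2 first.
- by apply: integral_ge0.
- by apply: nneseries_ge0.
congr (_ + _); rewrite muleCA; congr (_ * _); rewrite -nneseriesZl; last first.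
  move=> t _; rewrite mule_ge0 ?lee_fin//; apply: integral_ge0 => s _.
  by apply: iter_step_ge0; exact: step_ge0.
by apply: eq_eseriesr => t _; rewrite addn1 exprS EFinM -muleA iterSr.
Qed.

End decision_process.

(** * Bundled probabilities and bounded measurable functions *)

Section as_probability.
Context {d : measure_display} {T : measurableType d} {R : realType}.
Variables (m : {measure set T -> \bar R}) (m1 : m [set: T] = 1%E).

Definition as_probability_def of m [set: T] = 1%E : set T -> \bar R := m.
HB.instance Definition _ := Measure.copy (as_probability_def m1) m.
HB.instance Definition _ :=
  Measure_isProbability.Build _ _ _ (as_probability_def m1) m1.
Definition as_probability : probability T R := as_probability_def m1.
End as_probability.

Section bounded_measurable.
Context {R : realType} {d : measure_display} {T : measurableType d}.

Definition bmeas (f : T -> R) :=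
  measurable_fun [set: T] f /\ exists C : R, forall x, `|f x| <= C.

Lemma bmeas_integrable (m : probability T R) f : bmeas f ->
  m.-integrable [set: T] (EFin \o f).
Proof.
move=> [mf [C fC]]; apply: (@le_integrable _ _ _ _ _ _ _ (cst C%:E)) => //.
- exact/measurable_EFinP.
- by move=> x _ /=; rewrite lee_fin (le_trans (fC x))// ler_norm.
- exact: (@finite_measure_integrable_cst _ _ _ m).
Qed.

Lemma Rintegral_probability_bound (m : probability T R) (f : T -> R) (C : R) :
  measurable_fun [set: T] f -> (forall x, `|f x| <= C) ->
  `|\int[m]_x f x| <= C.
Proof.
move=> mf fC; have bf : bmeas f by split => //; exists C.
rewrite (le_trans (le_normr_Rintegral _ (bmeas_integrable m bf)))//.
have -> : C = \int[m]_x (cst C x).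
  by rewrite Rintegral_cst// [X in fine X](probability_setT m) mulr1.
apply: le_Rintegral => //.
- by apply: integrable_norm; exact: bmeas_integrable.
- exact: (@finite_measure_integrable_cst _ _ _ m).
Qed.

Lemma integrable_mulb (m : {measure set T -> \bar R}) (k f : T -> R) :
  m.-integrable [set: T] (EFin \o k) -> bmeas f ->
  m.-integrable [set: T] (fun x => (k x * f x)%:E).
Proof.
move=> ik [mf [C fC]].
have ig : m.-integrable [set: T] (fun x => (`|C|%:E * (EFin \o k) x)%E).
  exact: integrableZl.
apply: le_integrable ig => //.
- apply/measurable_EFinP; apply: measurable_funM => //.
  by apply/measurable_EFinP; exact: measurable_int ik.
- move=> x _ /=; rewrite lee_fin !normrM mulrC ler_wpM2r// normr_id.
  by rewrite (le_trans (fC x))// ler_norm.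
Qed.

Lemma bmeasD f g : bmeas f -> bmeas g -> bmeas (fun x => f x + g x).
Proof.
move=> [mf [C fC]] [mg [D gD]]; split; first exact: measurable_funD.
by exists (C + D) => x; rewrite (le_trans (ler_normD _ _))// lerD.
Qed.

Lemma bmeasZ c f : bmeas f -> bmeas (fun x => c * f x).
Proof.
move=> [mf [C fC]]; split; first exact: measurable_funM.
by exists (`|c| * C) => x; rewrite normrM ler_wpM2l.
Qed.

Lemma bmeasB f g : bmeas f -> bmeas g -> bmeas (fun x => f x - g x).
Proof.
move=> bf /(bmeasZ (-1)) bg; have := bmeasD bf bg.
by under eq_fun do rewrite mulN1r.
Qed.

Lemma bmeas_cst c : bmeas (cst c).
Proof. by split => //; exists `|c|. Qed.

End bounded_measurable.

(** Tonelli for the positive and negative parts, followed by [fine]. Sections without a finite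
    integral receive the default value 0, without harm to measurability. *)
Lemma measurable_Rintegral_section (R : realType) (dS dA : measure_display)
    (S : measurableType dS) (A : measurableType dA)
    (mu : {sigma_finite_measure set A -> \bar R}) (g : S * A -> R) :
  measurable_fun [set: S * A] g ->
  measurable_fun [set: S] (fun s => \int[mu]_a g (s, a)).
Proof.
move=> mg; have mEg : measurable_fun [set: S * A] (EFin \o g).
  exact/measurable_EFinP.
rewrite (_ : (fun s => _) = fun s => fine (
    fubini_F mu (fun x => (EFin \o g)^\+ x)%E s -
    fubini_F mu (fun x => (EFin \o g)^\- x)%E s)%E); last first.
  by apply/funext => s; rewrite /Rintegral integralE; congr (fine (_ - _));
    apply: eq_integral => a _; rewrite ?funeposE ?funenegE.
apply: measurableT_comp => //; apply: emeasurable_funB.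
  by apply: measurable_fun_fubini_tonelli_F => //; exact: measurable_funepos.
by apply: measurable_fun_fubini_tonelli_F => //; exact: measurable_funeneg.
Qed.

(** * Performance difference, and changes of initial law and reward *)

Section real_layer.
Context {R : realType} {dS dA : measure_display}.
Context {S : measurableType dS} {A : measurableType dA}.
Variable mu : {sigma_finite_measure set A -> \bar R}.
Implicit Types (M : mdp R S A) (p q : S -> A -> R).

Definition visitation_prob M p (hp : is_policy mu p) : probability S R :=
  as_probability (visitation_measureT M hp).

Lemma integral_visitation M p (hp : is_policy mu p) f :
  (\int[visitation mu M p]_s f s = \int[visitation_prob M hp]_s f s)%E.
Proof. by apply: integral_eq_measurable => B mB; exact: visitation_measureE. Qed.

Lemma expect_s_visitation M p (hp : is_policy mu p) f :
  expect_s (visitation mu M p) f = \int[visitation_prob M hp]_s f s.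
Proof. by rewrite /expect_s integral_visitation. Qed.

(** Representing functionals only see nonnegative functions, so the two parts of [f] are treated
    separately; multiplication by the positive [p s a] commutes with taking parts. *)
Lemma expect_aE p (hp : is_policy mu p) s f : measurable_fun [set: A] f ->
  expect_a mu p s f = \int[mu]_a (p s a * f a).
Proof.
move=> mf; rewrite /expect_a /Rintegral; congr fine.
have [mp p0 _] := hp.
have ha := represents_action_law hp s.
have mEf : measurable_fun [set: A] (EFin \o f) by exact/measurable_EFinP.
have e : (fun a => (p s a * f a)%:E) = (fun a => (p s a)%:E * (EFin \o f) a)%E.
  by apply/funext => a; rewrite EFinM.
have pos : (fun a => (p s a * f a)%:E)^\+%E =
    fun a => ((p s a)%:E * (EFin \o f)^\+ a)%E.
  apply/funext => a; rewrite !funeposE /=.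
  by rewrite -!EFin_max -EFinM maxr_pMr ?ltW// mulr0.
have neg : (fun a => (p s a * f a)%:E)^\-%E =
    fun a => ((p s a)%:E * (EFin \o f)^\- a)%E.
  apply/funext => a; rewrite !funenegE /=.
  by rewrite -!EFin_max -EFinM maxr_pMr ?ltW// mulr0 mulrN.
rewrite [RHS]integralE pos neg.
rewrite -(represents_integral ha (funepos_ge0 _)); last exact: measurable_funepos.
rewrite -(represents_integral ha (funeneg_ge0 _)); last exact: measurable_funeneg.
(* The splitting into parts takes place under the bundled copy of [action_law]; the two parts then
   return to the bare one. *)
have -> : (\int[action_law mu p s]_a (f a)%:E =
    \int[posfun_measure (represents_action_law hp s).1]_a (f a)%:E)%E.
  by apply: integral_eq_measurable => B mB; exact: (represents_action_law hp s).2.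
rewrite integralE; congr (_ - _)%E;
  apply: integral_eq_measurable => B mB; apply/esym;
  exact: (represents_action_law hp s).2.
Qed.

Lemma policy_integrable p (hp : is_policy mu p) s :
  mu.-integrable [set: A] (EFin \o p s).
Proof.
have [mp p0 p1] := hp; apply/integrableP; split.
  by apply/measurable_EFinP; exact: (measurableT_comp mp (pair1_measurable s)).
rewrite (_ : (fun x => _) = fun a => (p s a)%:E) ?p1 ?ltry//.
by apply/funext => a /=; rewrite ger0_norm// ltW.
Qed.

Lemma bmeas_value M p : is_policy mu p -> bmeas (value mu M p).
Proof.
move=> hp; split; first exact: measurable_value.
by exists (value_bound M) => s; rewrite ger0_norm ?value_ge0 ?value_le.
Qed.

Lemma qvalue_norm M p s a : is_policy mu p -> `|qvalue mu M p s a| <= value_bound M.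
Proof. by move=> hp; rewrite ger0_norm ?qvalue_ge0 ?qvalue_le. Qed.

Lemma bmeas_qvalue M p s : is_policy mu p -> bmeas (qvalue mu M p s).
Proof.
move=> hp; split; last by exists (value_bound M) => a; exact: qvalue_norm.
exact: (measurableT_comp (measurable_qvalue M hp) (pair1_measurable s)).
Qed.

Lemma actE p (hp : is_policy mu p) (f : S * A -> R) s :
  bmeas (fun a => f (s, a)) ->
  act mu p (EFin \o f) s = (\int[mu]_a (p s a * f (s, a)))%:E.
Proof.
move=> bf; rewrite /act /Rintegral fineK//.
apply: integrable_fin_num => //.
exact: integrable_mulb (policy_integrable hp s) bf.
Qed.

Lemma value_act M p s : is_policy mu p ->
  value mu M p s = \int[mu]_a (p s a * qvalue mu M p s a).
Proof.
move=> hp; apply: EFin_inj; rewrite (bellman_value M hp).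
by rewrite -(actE hp (f := fun x => qvalue mu M p x.1 x.2))//; exact: bmeas_qvalue.
Qed.

Lemma EFin_Rintegral (m : probability S R) f : bmeas f ->
  (\int[m]_s (f s)%:E = (\int[m]_s f s)%:E)%E.
Proof.
move=> bf; rewrite /Rintegral fineK//.
by apply: integrable_fin_num => //; exact: bmeas_integrable.
Qed.

(* [k] is a signed kernel such as a difference of two policies. *)
Lemma bmeas_kernel_average (k f : S -> A -> R) (C : R) :
  measurable_fun [set: S * A] (fun x => k x.1 x.2) ->
  measurable_fun [set: S * A] (fun x => f x.1 x.2) ->
  (forall s, `|\int[mu]_a (k s a * f s a)| <= C) ->
  bmeas (fun s => \int[mu]_a (k s a * f s a)).
Proof.
move=> mk mf kfC; split; last by exists C.
apply: (measurable_Rintegral_section mu (g := fun x => k x.1 x.2 * f x.1 x.2)).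
exact: measurable_funM.
Qed.

Lemma policy_average_bound p (hp : is_policy mu p) s f (C : R) : bmeas f ->
  (forall a, `|f a| <= C) -> `|\int[mu]_a (p s a * f a)| <= C.
Proof.
move=> bf fC; have ip := policy_integrable hp s; have [_ p0 p1] := hp.
rewrite (le_trans (le_normr_Rintegral _ (integrable_mulb ip bf)))//.
have -> : C = \int[mu]_a (C * p s a).
  by rewrite RintegralZl// /Rintegral p1 mulr1.
apply: le_Rintegral => //.
- by apply: integrable_norm; exact: integrable_mulb.
- by rewrite (_ : _ \o _ = fun x => C%:E * (EFin \o p s) x)%E//; exact: integrableZl.
- move=> a _; rewrite normrM (ger0_norm (ltW (p0 s a))) mulrC.
  by rewrite ler_wpM2r// ltW.
Qed.

Lemma bmeas_policy_average p (hp : is_policy mu p) (f : S -> A -> R) (C : R) :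
  measurable_fun [set: S * A] (fun x => f x.1 x.2) ->
  (forall s a, `|f s a| <= C) -> bmeas (fun s => \int[mu]_a (p s a * f s a)).
Proof.
move=> mf fC; have [mp _ _] := hp; apply: (@bmeas_kernel_average _ _ C) => // s.
apply: policy_average_bound => //; split; last by exists C.
exact: (measurableT_comp mf (pair1_measurable s)).
Qed.

Section flow.
Variables (M : mdp R S A) (p : S -> A -> R) (hp : is_policy mu p).
Local Notation nu := (visitation_prob M hp).

Definition policy_reward (s : S) : R := fine (act mu p (mean_reward M) s).

Lemma EFin_policy_reward s : (policy_reward s)%:E = act mu p (mean_reward M) s.
Proof.
rewrite /policy_reward fineK// ge0_fin_numE ?act_reward_ge0//.
apply: (@le_lt_trans _ _ `|rmax M|%:E); last exact: ltry.
apply: (act_le hp s (normr_ge0 _) (@mean_reward_ge0 _ _ _ _ _ M)).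
  exact: measurable_mean_reward.
exact: mean_reward_le.
Qed.

Lemma bmeas_policy_reward : bmeas policy_reward.
Proof.
split.
  by apply: measurableT_comp => //; exact: measurable_act_reward.
exists `|rmax M| => s; rewrite ger0_norm; last first.
  by rewrite -lee_fin EFin_policy_reward; exact: act_reward_ge0.
rewrite -lee_fin EFin_policy_reward.
apply: (act_le hp s (normr_ge0 _) (@mean_reward_ge0 _ _ _ _ _ M)).
  exact: measurable_mean_reward.
exact: mean_reward_le.
Qed.

(** Apply the flow equation of the visitation of [p] to V^q. What remains is gamma times the average
    of one [p]-step of V^q; adding the mean reward of [p] completes it to the [p]-average of Q^q.
    The identity is free of subtraction because the computation runs in the extended reals. *)
Lemma flow_identity q (hq : is_policy mu q) :
  \int[nu]_s value mu M q s + \int[nu]_s policy_reward s =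
  (1 - discount M) * performance mu M q +
  \int[nu]_s \int[mu]_a (p s a * qvalue mu M q s a).
Proof.
have g0 : 0 <= discount M by rewrite ltW// discount_gt0.
have V0 s : (0 <= (value mu M q s)%:E)%E by rewrite lee_fin value_ge0.
have mV : measurable_fun [set: S] (EFin \o value mu M q).
  by apply/measurable_EFinP; exact: measurable_value.
have bQ : bmeas (fun s => \int[mu]_a (p s a * qvalue mu M q s a)).
  apply: (bmeas_policy_average hp (C := value_bound M)) => [|s a].
    exact: measurable_qvalue.
  exact: qvalue_norm.
apply: EFin_inj; rewrite !EFinD EFinM (performance_value M hq).
rewrite -(EFin_Rintegral nu bQ) -(EFin_Rintegral nu (bmeas_value M hq)).
rewrite -(EFin_Rintegral nu bmeas_policy_reward).
have flow := visitation_flow M hp V0 mV.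
rewrite [X in (X + _)%E]flow -addeA; congr (_ + _)%E.
have mT : measurable_fun [set: S * A] (fun x => \int[trans M x]_s' (value mu M q s')%:E)%E.
  exact: measurable_trans.
have T0 x : (0 <= \int[trans M x]_s' (value mu M q s')%:E)%E by exact: integral_ge0.
have s0 := step_ge0 M hp V0.
have ms := measurable_step M hp V0 mV.
rewrite -[X in (X + _)%E = _](ge0_integralZl_EFin _ _ (fun s _ => s0 s))//.
rewrite -ge0_integralD//.
- apply: eq_integral => s _.
  have PA := posfun_act hp s.
  rewrite -(actE hp (f := fun x => qvalue mu M q x.1 x.2)); last exact: bmeas_qvalue.
  rewrite EFin_policy_reward /step -(posfunZ PA)// -(posfunD PA)//.
  + congr (act _ _ _ s); apply/funext => -[s1 a1].
    by rewrite /= (bellman_qvalue M hq) addeC.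
  + by move=> x; rewrite mule_ge0.
  + exact: mean_reward_ge0.
  + exact: measurable_funeM.
  + exact: measurable_mean_reward.
- by move=> s _; rewrite mule_ge0.
- exact: measurable_funeM.
- by move=> s _; rewrite EFin_policy_reward; exact: act_reward_ge0.
- by apply/measurable_EFinP; exact: bmeas_policy_reward.1.
Qed.

(** The case q = p: V^p is the [p]-average of Q^p, so the two cancel. *)
Lemma performance_policy_reward :
  (1 - discount M) * performance mu M p = \int[nu]_s policy_reward s.
Proof.
have e : \int[nu]_s \int[mu]_a (p s a * qvalue mu M p s a) =
    \int[nu]_s value mu M p s.
  by apply: eq_Rintegral => s _; rewrite -(value_act M s hp).
by have := flow_identity hp; rewrite e addrC => /addIr.
Qed.

(** Eliminate the mean reward of [p] between the identities at [q] and at [p], then write V^q as the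
    [q]-average of Q^q. *)
Lemma performance_difference q (hq : is_policy mu q) :
  (1 - discount M) * (performance mu M q - performance mu M p) =
  \int[nu]_s \int[mu]_a ((q s a - p s a) * qvalue mu M q s a).
Proof.
have bQ : bmeas (fun s => \int[mu]_a (p s a * qvalue mu M q s a)).
  apply: (bmeas_policy_average hp (C := value_bound M)) => [|s a].
    exact: measurable_qvalue.
  exact: qvalue_norm.
rewrite mulrBr [X in _ - X]performance_policy_reward.
have := flow_identity hq.
set V := \int[nu]_s value mu M q s; set r := \int[nu]_s policy_reward s.
set J := (X in X - r); set W := \int[nu]_s \int[mu]_a (p s a * _).
move=> e; have {e} -> : J - r = V - W.
  by apply/eqP; rewrite subr_eq addrAC eq_sym subr_eq; apply/eqP.
rewrite /V /W -RintegralB//; last 2 first.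
- by apply: bmeas_integrable; exact: bmeas_value.
- exact: bmeas_integrable.
apply: eq_Rintegral => s _; rewrite value_act// -RintegralB//; last 2 first.
- by apply: integrable_mulb; [exact: policy_integrable|exact: bmeas_qvalue].
- by apply: integrable_mulb; [exact: policy_integrable|exact: bmeas_qvalue].
by apply: eq_Rintegral => a _; rewrite mulrBl.
Qed.

End flow.

(** [value] does not look at the initial law, so varying that law turns any average of V into a
    performance. *)
Definition with_init (M : mdp R S A) (i : probability S R) : mdp R S A :=
  Mdp i (trans M) (discount_gt0 M) (discount_lt1 M)
    (measurable_reward M) (reward_ge0 M) (reward_le M).

Definition trans_prob (M : mdp R S A) (x : S * A) : probability S R :=
  as_probability (prob_kernel x : trans M x [set: S] = 1%E).

(** The immediate reward does not depend on the policy, so regularity of Q in the parameter reduces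
    to that of a performance. *)
Lemma qvalue_performance (M : mdp R S A) p s a : is_policy mu p ->
  qvalue mu M p s a = fine (mean_reward M (s, a)) +
    discount M * performance mu (with_init M (trans_prob M (s, a))) p.
Proof.
move=> hp; apply: EFin_inj; rewrite (bellman_qvalue M hp) EFinD EFinM fineK.
  by congr (_ + _ * _)%E; rewrite (performance_value (with_init M _) hp).
rewrite ge0_fin_numE ?mean_reward_ge0//.
by rewrite (le_lt_trans (mean_reward_le _ _))// ltry.
Qed.

Section state_reward.
Variables (M : mdp R S A) (g : S -> R) (C : R).
Hypotheses (mg : measurable_fun [set: S] g) (gC : forall s, `|g s| <= C).

Let mr : measurable_fun [set: (S * A) * S] (fun x => g x.1.1 + C).
Proof.
apply: measurable_funD => //; apply: (measurableT_comp mg).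
by apply: measurableT_comp measurable_fst measurable_fst.
Qed.

Let r0 (s : S) (a : A) (s' : S) : 0 <= g s + C.
Proof. by have := gC s; rewrite ler_norml => /andP[]; lra. Qed.

Let rle (s : S) (a : A) (s' : S) : g s + C <= 2 * C.
Proof. by have := gC s; rewrite ler_norml => /andP[]; lra. Qed.

(** Adding [C] makes the reward nonnegative and at most [2 * C]; since the visitation is a
    probability, the shift adds exactly [C] to the normalized performance. *)
Definition with_state_reward : mdp R S A :=
  @Mdp R dS dA S A (discount M) (init M) (trans M) (fun s a s' => g s + C) (2 * C)
    (discount_gt0 M) (discount_lt1 M) mr r0 rle.

Lemma performance_state_reward p (hp : is_policy mu p) :
  (1 - discount M) * performance mu with_state_reward p =
  \int[visitation_prob M hp]_s g s + C.
Proof.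
have -> : discount M = discount with_state_reward by [].
rewrite (performance_policy_reward _ hp).
have pr s : policy_reward with_state_reward p s = g s + C.
  apply: EFin_inj; rewrite (EFin_policy_reward _ hp).
  rewrite -(act_fst hp (f := fun s => (g s + C)%:E)) => [|s']; last first.
    by have := gC s'; rewrite lee_fin ler_norml => /andP[]; lra.
  congr (act _ _ _ s); apply/funext => x; rewrite /mean_reward /=.
  transitivity (\int[trans M x]_s' (cst (g x.1 + C)%:E s'))%E; first by [].
  by rewrite integral_cst// prob_kernel mule1.
under eq_Rintegral do rewrite pr.
(* The visitation depends on the initial law, the transitions, the discount and the policy, all
   untouched by the change of reward. *)
have -> : \int[visitation_prob with_state_reward hp]_s (g s + C) =
    \int[visitation_prob M hp]_s (g s + C).
  by congr fine.
have bg : bmeas g by split => //; exists C.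
rewrite RintegralD//; last 2 first.
- exact: bmeas_integrable.
- by apply: bmeas_integrable; exact: bmeas_cst.
by congr (_ + _); rewrite Rintegral_cst//
  [X in fine X](probability_setT (visitation_prob M hp)) mulr1.
Qed.

End state_reward.

End real_layer.

(** * First-order approximation and mean value estimates *)

Lemma near_along (T : Type) (V : topologicalType) (F : set_system T) (v : T -> V)
    (y : V) (P : V -> Prop) :
  v @ F --> y -> (\forall z \near y, P z) -> \forall t \near F, P (v t).
Proof. by move=> vy; exact: vy. Qed.

Section differential_approximation.
Context {R : realType} {V W : normedModType R}.

(** Epsilon form of Frechet differentiability for a bare function [L]; linearity and boundedness are
    supplied in [approx_differentiable]. *)
Definition approx (f : V -> W) (x : V) (L : V -> W) := forall e : R, 0 < e ->
  \forall y \near x, `|f y - f x - L (y - x)| <= e * `|y - x|.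

Lemma near_translate (x : V) (P : V -> Prop) :
  (\forall h \near (0 : V), P h) <-> (\forall y \near x, P (y - x)).
Proof.
split=> /nbhs_ballP[r r0 rP]; apply/nbhs_ballP; exists r => // y /=.
  rewrite -ball_normE /= => xyr; apply: rP.
  by rewrite -ball_normE /= sub0r normrN distrC.
rewrite -ball_normE /= sub0r normrN => yr; rewrite -[y](addrK x); apply: rP.
by rewrite -ball_normE /= opprD addrCA subrr addr0 normrN.
Qed.

Lemma differentiable_approx (f : V -> W) (x : V) :
  differentiable f x -> approx f x ('d f x).
Proof.
move=> df e e0; have /eqaddoP/(_ e e0) h := diff_locally df.
apply: filterS ((near_translate x _).1 h) => y.
rewrite -[X in `|X| <= _ -> _]/(f (y - x + x) - (f x + 'd f x (y - x))).
by rewrite subrK opprD addrA.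
Qed.

Lemma approx_differentiable (f : V -> W) (x : V) (L : V -> W) (K : R) :
  linear L -> (forall u, `|L u| <= K * `|u|) -> approx f x L ->
  differentiable f x /\ 'd f x = L :> (V -> W).
Proof.
move=> linL LK fL.
pose LL : {linear V -> W} := HB.pack L (GRing.isLinear.Build _ _ _ _ _ linL).
have cL : continuous LL.
  apply/linear_bounded_continuous/linear_boundedP.
  exists K; split; first exact: num_real.
  by move=> M KM u; rewrite (le_trans (LK u))// ler_wpM2r// ltW.
have fo : f \o shift x = cst (f x) + LL +o_ 0 id.
  apply/eqaddoP => e e0; apply/(near_translate x _).2.
  apply: filterS (fL e e0) => y.
  rewrite -[X in _ -> `|X| <= _]/(f (y - x + x) - (f x + L (y - x))).
  by rewrite subrK opprD addrA.
have dL := diff_unique cL fo; split => //.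
by apply/diff_locallyP; rewrite dL; split.
Qed.

Lemma differential_bound (f : V -> W) (x : V) : differentiable f x ->
  exists2 K : R, 0 < K & forall u, `|'d f x u| <= K * `|u|.
Proof. by move=> df; apply: linear_lipschitz; exact: diff_continuous. Qed.

(** Increments that agree to second order have the same linear part. This transfers derivatives from
    a version with frozen coefficients to the true function. *)
Lemma differentiable_quadratic (f g : V -> W) (x : V) (C : R) :
  differentiable g x ->
  (\forall y \near x, `|f y - f x - (g y - g x)| <= C * `|y - x| ^+ 2) ->
  differentiable f x /\ 'd f x = 'd g x :> (V -> W).
Proof.
move=> dg fg; have [K K0 gK] := differential_bound dg.
apply: (@approx_differentiable f x ('d g x) K) => //; first exact: linearP.
move=> e e0; have e20 : 0 < e / 2 by rewrite divr_gt0.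
(* The denominator [|C| + 1] is positive and dominates [C] whatever its sign; each half of [e] pays
   for one remainder. *)
have c0 : 0 < e / 2 / (`|C| + 1) by rewrite divr_gt0// ltr_wpDl.
near=> y.
have h1 : `|f y - f x - (g y - g x)| <= C * `|y - x| ^+ 2 by near: y.
have h2 : `|g y - g x - 'd g x (y - x)| <= e / 2 * `|y - x|.
  by near: y; exact: differentiable_approx.
have h3 : `|y - x| < e / 2 / (`|C| + 1).
  near: y; apply/nbhs_ballP; exists (e / 2 / (`|C| + 1)) => // y.
  by rewrite -ball_normE /= distrC.
have -> : f y - f x - 'd g x (y - x) =
    (f y - f x - (g y - g x)) + (g y - g x - 'd g x (y - x)).
  by rewrite addrA subrK.
rewrite (le_trans (ler_normD _ _))// [leRHS](_ : _ = e / 2 * `|y - x| + e / 2 * `|y - x|).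
  2: by rewrite -mulrDl -splitr.
rewrite lerD//; apply: (le_trans h1); rewrite expr2 mulrA ler_wpM2r//.
apply: (@le_trans _ _ ((`|C| + 1) * `|y - x|)).
  by rewrite ler_wpM2r// (le_trans (ler_norm _))// lerDl.
by rewrite mulrC -ler_pdivlMr ?ltr_wpDl// ltW.
Unshelve. all: by end_near. Qed.

End differential_approximation.

Lemma differential_at_max (R : realType) (V : normedModType R) (f : V -> R)
    (x u : V) :
  differentiable f x -> (forall y, f y <= f x) -> 'd f x u = 0.
Proof.
move=> df fx.
suff h w : 'd f x w <= 0.
  by apply/eqP; rewrite eq_le h /= -oppr_le0 -linearN h.
apply/ler_addgt0Pl => e e0; rewrite addr0.
have [->|w0] := eqVneq w 0; first by rewrite linear0 ltW.
have nw : 0 < `|w| by rewrite normr_gt0.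
have /nbhs_ballP[r /= r0 rP] := differentiable_approx df (divr_gt0 e0 nw).
(* [t] puts the test point at distance r / 2, inside the ball; the error allowed there is exactly
   [t * e]. *)
pose t := r / 2 / `|w|; have t0 : 0 < t by rewrite !divr_gt0.
have tw : `|t *: w| = r / 2.
  by rewrite normrZ gtr0_norm// /t divfK// gt_eqF.
have := rP (x + t *: w); rewrite -ball_normE /= opprD addrA subrr sub0r normrN tw.
rewrite ltr_pdivrMr// ltr_pMr// ltr1n => /(_ isT).
rewrite [x + _ - x]addrAC subrr add0r tw linearZ /= => /ler_normlP[+ _].
have -> : e / `|w| * (r / 2) = t * e by rewrite /t; field; rewrite gt_eqF.
rewrite opprB lerBlDr => h.
rewrite -(ler_pM2l t0) (le_trans h)// gerDl subr_le0.
exact: fx.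
Qed.

Section mean_value.
Context {R : realType} {V : normedModType R}.

Lemma is_derive_segment (f : V -> R) (x w : V) (t : R) :
  differentiable f (x + t *: w) ->
  is_derive t 1 (fun t => f (x + t *: w)) ('d f (x + t *: w) w).
Proof.
move=> df; pose l := fun t : R => x + t *: w.
have e : (fun h : R => h^-1 *: (((f \o l) \o shift t) (h *: 1) - (f \o l) t)) =
    (fun h : R => h^-1 *: ((f \o shift (l t)) (h *: w) - f (l t))).
  apply/funext => h /=; congr (_ *: (f _ - _)).
  by rewrite /l scalerDl [h *: 1]mulr1 addrCA.
have D := @diff_derivable _ _ _ _ _ w df; split; first by rewrite /derivable e.
by rewrite -deriveE// /derive e.
Qed.

(** Mean value theorem along the segment to the centre, which stays in the ball. *)
Lemma lipschitz_of_differential (f : V -> R) (x : V) (r K : R) :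
  (forall y, ball x r y -> differentiable f y) ->
  (forall y u, ball x r y -> `|'d f y u| <= K * `|u|) ->
  forall y, ball x r y -> `|f y - f x| <= K * `|y - x|.
Proof.
move=> df fK y xy; pose w := y - x.
have seg (t : R) : t \in `[0, 1] -> ball x r (x + t *: w).
  rewrite in_itv /= => /andP[t0 t1]; move: xy; rewrite -!ball_normE /=.
  rewrite opprD addrA subrr sub0r normrN normrZ ger0_norm// /w distrC.
  by apply: le_lt_trans; rewrite ler_piMl.
have der (t : R) : t \in `[0, 1] ->
    is_derive t 1 (fun t => f (x + t *: w)) ('d f (x + t *: w) w).
  by move=> t01; apply: is_derive_segment; apply: df; exact: seg.
have [c c01] := @MVT_segment R (fun t => f (x + t *: w))
  (fun t => 'd f (x + t *: w) w) 0 1 ler01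
  (fun t t01 => der t (subset_itv_oo_cc t01))
  (derivable_within_continuous (fun t t01 => @ex_derive _ _ _ _ _ _ _ (der t t01))).
rewrite scale1r scale0r addr0 subr0 mulr1 (_ : x + w = y); last first.
  by rewrite addrC subrK.
move=> ->.
by apply: fK; exact: seg.
Qed.

End mean_value.

(** * Measurability of differentials and differentiation under the integral *)

Section measurable_differential.
Context {R : realType} {V : normedModType R}.
Context {d : measure_display} {T : measurableType d}.
Variables (F : V -> T -> R) (x0 : V).
Hypotheses (mF : forall v, measurable_fun [set: T] (F v))
  (dF : forall t, differentiable (F ^~ t) x0).

Local Notation D u := (fun t => 'd (F ^~ t) x0 u).

Lemma near_harmonic (u : V) : (fun k : nat => x0 + k.+1%:R^-1 *: u) @ \oo --> x0.
Proof.
rewrite -[X in _ --> X]addr0; apply: cvgD; first exact: cvg_cst.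
rewrite -(scale0r u); apply: cvgZr_tmp; exact: cvg_harmonic.
Qed.

(** Presents the differential as a sequential limit of difference quotients, whence its
    measurability in [t] and, under domination, its bound. *)
Lemma quotient_cvg (u : V) (t : T) :
  (fun k : nat => k.+1%:R * (F (x0 + k.+1%:R^-1 *: u) t - F x0 t)) @ \oo --> D u t.
Proof.
apply/cvgrPdist_le => e e0.
(* Dividing by |u| + 1 rather than |u| also covers u = 0. *)
have e1 : 0 < e / (`|u| + 1) by rewrite divr_gt0// ltr_wpDl.
have := near_along (near_harmonic u) (differentiable_approx (dF t) e1).
apply: filterS => k /=.
rewrite (_ : x0 + _ *: u - x0 = k.+1%:R^-1 *: u); last by rewrite addrAC subrr add0r.
have k0 : 0 < k.+1%:R :> R by [].
have key (a D : R) : `|a - k.+1%:R^-1 * D| <= e / (`|u| + 1) * `|k.+1%:R^-1 *: u| ->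
    `|D - k.+1%:R * a| <= e.
  move=> h; rewrite distrC (_ : _ - D = k.+1%:R * (a - k.+1%:R^-1 * D)); last first.
    by rewrite mulrBr mulVKf// gt_eqF.
  rewrite normrM gtr0_norm// -ler_pdivlMl// (le_trans h)// normrZ gtr0_norm ?invr_gt0//.
  rewrite mulrCA ler_wpM2l ?invr_ge0// mulrAC ler_pdivrMr ?ltr_wpDl//.
  by rewrite ler_wpM2l ?(ltW e0)// lerDl.
by rewrite linearZ; exact: key.
Qed.

Lemma measurable_differential u : measurable_fun [set: T] (D u).
Proof.
apply: (measurable_fun_cvg (h := fun k t =>
  k.+1%:R * (F (x0 + k.+1%:R^-1 *: u) t - F x0 t))).
- by move=> k; apply: measurable_funM => //; apply: measurable_funB.
- by move=> t _; exact: quotient_cvg.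
Qed.

End measurable_differential.

Section dominated_differentiation.
Context {R : realType} {V : normedModType R}.
Context {d : measure_display} {T : measurableType d}.
Variables (m : {measure set T -> \bar R}) (F : V -> T -> R) (x0 : V) (H : T -> R).
Hypotheses (mF : forall v, measurable_fun [set: T] (F v))
  (iF : m.-integrable [set: T] (EFin \o F x0))
  (dF : forall t, differentiable (F ^~ t) x0)
  (H0 : forall t, 0 <= H t) (iH : m.-integrable [set: T] (EFin \o H))
  (lipF : \forall v \near x0, forall t, `|F v t - F x0 t| <= H t * `|v - x0|).

Local Notation D u := (fun t => 'd (F ^~ t) x0 u).

Lemma dominated_differential_bound u t : `|D u t| <= H t * `|u|.
Proof.
have c : (fun k : nat => `|k.+1%:R * (F (x0 + k.+1%:R^-1 *: u) t - F x0 t)|) @ \oo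
    --> `|D u t| by apply: cvg_norm; exact: quotient_cvg.
apply: (cvgr_to_le c).
have := near_along (@near_harmonic _ _ x0 u) lipF; apply: filterS => k /= /(_ t).
rewrite (_ : x0 + _ *: u - x0 = k.+1%:R^-1 *: u); last by rewrite addrAC subrr add0r.
rewrite normrZ gtr0_norm ?invr_gt0// => h.
by rewrite normrM gtr0_norm// -ler_pdivlMl// (le_trans h)// mulrCA.
Qed.

Let integrable_HZ (c : R) : m.-integrable [set: T] (fun t => (H t * c)%:E).
Proof.
rewrite (_ : (fun t => _) = fun t => (c%:E * (EFin \o H) t)%E).
  exact: integrableZl.
by apply/funext => t; rewrite mulrC EFinM.
Qed.

Lemma dominated_differential_integrable u : m.-integrable [set: T] (EFin \o D u).
Proof.
apply: le_integrable (integrable_HZ `|u|) => //.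
- by apply/measurable_EFinP; exact: measurable_differential.
- move=> t _ /=; rewrite lee_fin.
  by rewrite (le_trans (dominated_differential_bound _ _))// ler_norm.
Qed.

Let integrable_near : \forall v \near x0, m.-integrable [set: T] (EFin \o F v).
Proof.
apply: filterS lipF => v hv.
have i := integrableD measurableT (integrable_HZ `|v - x0|) (integrable_norm iF).
apply: le_integrable i => //; first exact/measurable_EFinP.
move=> t _ /=; rewrite lee_fin [leRHS]ger0_norm; last first.
  by rewrite addr_ge0// mulr_ge0.
by rewrite -[F v t](subrK (F x0 t)) (le_trans (ler_normD _ _))// lerD.
Qed.

Let I v := \int[m]_t F v t.
Let L u := \int[m]_t D u t.

Let linL : linear L.
Proof.
move=> c u v; rewrite /L.
rewrite -[X in _ = X + _]/(c * \int[m]_t D u t) -RintegralZl//; last first.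
  exact: dominated_differential_integrable.
rewrite -RintegralD//; last 2 first.
- rewrite (_ : _ \o _ = fun t => (c%:E * (EFin \o D u) t)%E)//.
  by apply: integrableZl => //; exact: dominated_differential_integrable.
- exact: dominated_differential_integrable.
by apply: eq_Rintegral => t _; rewrite linearP.
Qed.

Let L_bound u : `|L u| <= (\int[m]_t H t) * `|u|.
Proof.
rewrite (le_trans (le_normr_Rintegral _ (dominated_differential_integrable u)))//.
rewrite -RintegralZr//; apply: le_Rintegral => //.
- by apply: integrable_norm; exact: dominated_differential_integrable.
- exact: integrable_HZ.
- by move=> t _; exact: dominated_differential_bound.
Qed.

Let remainder v t := F v t - F x0 t - D (v - x0) t.

(** Dominated convergence is a statement on sequences: the normalized remainder tends to 0 pointwise
    and is at most 2 H, one H for the increment and one for the differential. *)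
Let sequential (v : nat -> V) (e : R) : 0 < e -> v @ \oo --> x0 ->
  (forall k, m.-integrable [set: T] (EFin \o F (v k))) ->
  (forall k t, `|F (v k) t - F x0 t| <= H t * `|v k - x0|) ->
  \forall k \near \oo, `|\int[m]_t (remainder (v k) t / `|v k - x0|)| <= e.
Proof.
move=> e0 vx0 iv lv.
pose rho k t := remainder (v k) t / `|v k - x0|.
have mrho k : measurable_fun [set: T] (rho k).
  apply: measurable_funM => //; apply: measurable_funB.
    exact: measurable_funB.
  exact: measurable_differential.
have rho0 t : rho ^~ t @ \oo --> 0.
  apply/cvgrPdist_le => z z0; 
  have := near_along vx0 (differentiable_approx (dF t) z0).
  apply: filterS => k /= h; rewrite sub0r normrN /rho normrM normfV normr_id.
  (* When v k = x0 the quotient is 0, as the inverse of 0 is 0. *)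
  have [->|n0] := eqVneq `|v k - x0| 0; first by rewrite invr0 mulr0 ltW.
  by rewrite ler_pdivrMr// lt0r n0 normr_ge0.
have rhoH k t : `|rho k t| <= H t * 2.
  rewrite /rho normrM normfV normr_id.
  have [->|n0] := eqVneq `|v k - x0| 0; first by rewrite invr0 mulr0 mulr_ge0.
  rewrite ler_pdivrMr ?lt0r ?n0 ?normr_ge0// (le_trans (ler_normB _ _))//.
  rewrite mulrAC mulr2n mulrDr mulr1 lerD//.
  exact: dominated_differential_bound.
have irho k : m.-integrable [set: T] (EFin \o rho k).
  apply: le_integrable (integrable_HZ 2) => //; first exact/measurable_EFinP.
  by move=> t _ /=; rewrite lee_fin (le_trans (rhoH k t))// ler_norm.
have rhoE t : (fun k => (rho k t)%:E) @ \oo --> 0%E.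
  by apply/fine_cvgP; split; [exact: nearW|exact: rho0].
have [_ _ c] := @dominated_convergence _ _ _ m _ measurableT
  (fun k => EFin \o rho k) (cst 0%E) (fun t => (H t * 2)%:E)
  (fun k => (measurable_EFinP _ _).2 (mrho k)) (measurable_cst _)
  (aeW _ (fun t _ => rhoE t))
  (integrable_HZ 2) (aeW _ (fun t k _ => rhoH k t)).
rewrite integral0 in c.
have /cvgrPdist_le/(_ e e0) : (fun k => \int[m]_t rho k t) @ \oo --> 0.
  by apply: fine_cvg; exact: c.
by apply: filterS => k; rewrite sub0r normrN.
Qed.

(** Neighbourhoods reduce to sequences by contradiction: a failing [e] yields, for each [k], a point
    at distance less than 1 / (k + 1) that violates the estimate. *)
Lemma dominated_differentiation :
  differentiable (fun v => \int[m]_t F v t) x0 /\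
  forall u, 'd (fun v => \int[m]_t F v t) x0 u = \int[m]_t 'd (F ^~ t) x0 u.
Proof.
suff h : approx I x0 L.
  have [dI dIL] := approx_differentiable linL L_bound h.
  by split => // u; rewrite dIL.
move=> e e0; apply: contrapT => nP.
have /nbhs_ballP[r /= r0 rP] : \forall v \near x0,
    (forall t, `|F v t - F x0 t| <= H t * `|v - x0|) /\
    m.-integrable [set: T] (EFin \o F v).
  by near do split.
have ex (k : nat) : exists v, [/\ ball x0 r v, `|v - x0| < k.+1%:R^-1 &
    ~ `|I v - I x0 - L (v - x0)| <= e * `|v - x0|].
  apply: contrapT => nex; apply: nP.
  apply/nbhs_ballP; exists (Num.min r k.+1%:R^-1).
    by rewrite /= lt_min r0 /= invr_gt0.
  move=> v; rewrite -ball_normE /= lt_min => /andP[vr vk].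
  apply: contrapT => nv; apply: nex; exists v; split => //.
    by rewrite -ball_normE.
  by rewrite distrC.
have [v vP] := choice ex.
have vx0 : v @ \oo --> x0.
  apply/cvgrPdist_lt => z z0; near=> k.
  rewrite distrC; have [_ + _] := vP k; move/lt_trans; apply.
  near: k; exact: near_infty_natSinv_lt (PosNum z0).
have [k _ /(_ k (leqnn k))] := @sequential v e e0 vx0
  (fun k => let: And3 h _ _ := vP k in (rP _ h).2)
  (fun k => let: And3 h _ _ := vP k in (rP _ h).1).
rewrite /=; have [bk _ nk] := vP k; have [lk ik] := rP _ bk.
(* The estimate is trivially true at x0, so the violating points differ from x0 and the
   normalization is meaningful. *)
have n0 : `|v k - x0| != 0.
  apply/eqP => n0; apply: nk; rewrite n0 mulr0.
  move/eqP: n0; rewrite normr_eq0 => /eqP e1; rewrite e1.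
  move/eqP: e1; rewrite subr_eq0 => /eqP ->.
  rewrite subrr sub0r normrN.
  by have := L_bound 0; rewrite normr0 mulr0.
move=> h; apply: nk; move: h.
have iB : m.-integrable [set: T] (EFin \o (fun t => F (v k) t - F x0 t)).
  exact: (integrableB measurableT ik iF).
have iD := dominated_differential_integrable (v k - x0).
have -> : \int[m]_t (remainder (v k) t / `|v k - x0|) =
    (I (v k) - I x0 - L (v k - x0)) / `|v k - x0|.
  by rewrite RintegralZr// ?RintegralB//; exact: (integrableB measurableT iB iD).
by rewrite normrM normfV normr_id ler_pdivrMr// lt0r n0 normr_ge0.
Unshelve. all: by end_near. Qed.

End dominated_differentiation.

(** * Implicit differentiation at a single point *)

Section implicit_function.
Context {R : realType} {U V W : normedModType R}.

(* Only the differentiability of [G] at one point is available, which is enough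
   because the solution [g] is known to be continuous there. *)
Lemma implicit_differentiable (G : U * V -> W) (g : U -> V) (x : U)
    (B : W -> V) (K : R) :
  differentiable G (x, g x) ->
  linear B -> (forall w, `|B w| <= K * `|w|) ->
  (forall v, B ('d G (x, g x) (0, v)) = v) ->
  {for x, continuous g} -> (forall y, G (y, g y) = 0) ->
  differentiable g x /\
  forall u, 'd g x u = - B ('d G (x, g x) (u, 0)).
Proof.
move=> dG linB BK BG cg Gg.
have [c c0 Gc] := differential_bound dG.
pose D := 'd G (x, g x); pose L u := - B (D (u, 0)).
pose BL : {linear W -> V} := HB.pack B (GRing.isLinear.Build _ _ _ _ _ linB).
pose K1 := `|K| + 1; have K10 : 0 < K1 by rewrite ltr_wpDl.
have BK1 w : `|B w| <= K1 * `|w|.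
  by rewrite (le_trans (BK w))// ler_wpM2r// (le_trans (ler_norm _))// lerDl.
have npair (u : U) : `|(u, 0 : V)| = `|u|.
  by rewrite prod_normE /= normr0; apply/max_idPl.
have LK u : `|L u| <= K1 * c * `|u|.
  rewrite normrN (le_trans (BK1 _))// -mulrA ler_wpM2l ?(ltW K10)//.
  by rewrite (le_trans (Gc _))// npair.
have Dsplit (u : U) (v : V) : D (u, v) = D (u, 0) + D (0, v).
  by rewrite -linearD; congr (D _); apply/pair_equal_spec; rewrite /= addr0 add0r.
have linL : linear L.
  move=> a u v; rewrite /L -[B]/(BL : W -> V).
  have -> : (a *: u + v, 0 : V) = a *: (u, 0) + (v, 0).
    by apply/pair_equal_spec; rewrite /= scaler0 addr0.
  by rewrite linearP linearP opprD scalerN.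
(* [G] vanishes along the graph, so applying [B] to the first-order remainder leaves, up to sign,
   the increment of [g] minus its candidate linear part. *)
pose rem y := G (y, g y) - G (x, g x) - D ((y, g y) - (x, g x)).
have remE y : g y - g x - L (y - x) = - B (rem y).
  rewrite /rem !Gg subrr sub0r Dsplit /L -[B]/(BL : W -> V) !(linearN, linearD) /=.
  by rewrite !opprK addrC (BG (g y - g x)).
have remK (e : R) : 0 < e ->
    \forall y \near x, `|rem y| <= e * (`|y - x| + `|g y - g x|).
  move=> e0; have cp : (fun y => (y, g y)) @ x --> (x, g x).
    by apply: cvg_pair => //; exact: cvg_id.
  have := near_along cp (differentiable_approx dG e0); apply: filterS => y /= h.
  rewrite (le_trans h)// ler_wpM2l ?(ltW e0)// prod_normE /= ge_max.
  by rewrite lerDl lerDr !normr_ge0.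
(* Bootstrap: near [x], continuity of [g] makes K1 |rem y| at most half of |y - x| + |g y - g x|;
   absorbing half of |g y - g x| on the left gives the constant [l]. *)
pose l := 2 * (K1 * c) + 1.
have step1 : \forall y \near x, `|g y - g x| <= l * `|y - x|.
  have e0 : 0 < (2 * K1)^-1 by rewrite invr_gt0 mulr_gt0.
  apply: filterS (remK _ e0) => y h.
  have h1 : `|g y - g x| <= K1 * c * `|y - x| + K1 * `|rem y|.
    rewrite -[g y - g x](subrK (L (y - x))) remE addrC (le_trans (ler_normD _ _))//.
    by rewrite lerD// normrN.
  have h2 : K1 * `|rem y| <= (`|y - x| + `|g y - g x|) / 2.
    rewrite (le_trans (ler_wpM2l (ltW K10) h))// invfM mulrA mulrCA mulfV ?gt_eqF// mulr1.
    by rewrite mulrC.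
  by rewrite /l; lra.
have [dg dgL] : differentiable g x /\ 'd g x = L :> (U -> V).
  apply: approx_differentiable LK _ => // e e0.
  have l0 : 0 <= l by rewrite /l addr_ge0// mulr_ge0// mulr_ge0 ?ltW.
  (* The Lipschitz bound turns |y - x| + |g y - g x| into (1 + l) |y - x|; this factor and [K1] are
     divided out in advance. *)
  have e20 : 0 < e / (K1 * (1 + l)) by rewrite divr_gt0// mulr_gt0// ltr_pwDl.
  apply: filterS2 step1 (remK _ e20) => y h1 h2; rewrite remE normrN.
  rewrite (le_trans (BK1 _))// (le_trans (ler_wpM2l (ltW K10) h2))//.
  rewrite mulrA [K1 * (e / _)](_ : _ = e / (1 + l)); last first.
    by field; rewrite !gt_eqF// ltr_pwDl.
  rewrite -mulrA ler_wpM2l ?(ltW e0)// ler_pdivrMl ?ltr_pwDl//.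
  by rewrite mulrDl mul1r lerD2l.
by split => // u; rewrite dgL.
Qed.

End implicit_function.

(** * Coordinates, rows and pairs *)

Section coordinates.
Context {R : realType} {n : nat}.

Lemma normr_coord (u : 'rV[R]_n) i : `|u 0 i| <= `|u|.
Proof.
rewrite [leRHS]mx_normrE.
exact: (le_bigmax _ (fun i : 'I_1 * 'I_n => `|u i.1 i.2|) (0, i)).
Qed.

Lemma normr_le_coord (u : 'rV[R]_n) (c : R) : 0 <= c ->
  (forall i, `|u 0 i| <= c) -> `|u| <= c.
Proof.
move=> c0 uc; rewrite [leLHS]mx_normrE.
by apply: bigmax_le => // -[i j] _ /=; rewrite ord1.
Qed.

(** The norm is the maximum of the coordinates; the factor [n] counts the basis vectors. *)
Lemma linear_rV_bound (W : normedModType R) (f : {linear 'rV[R]_n -> W}) (c : R) :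
  (forall i, `|f (delta_mx 0 i)| <= c) -> forall u, `|f u| <= n%:R * c * `|u|.
Proof.
move=> fc u; rewrite [in leLHS](row_sum_delta u) linear_sum.
rewrite (le_trans (ler_norm_sum _ _ _))//.
rewrite (@le_trans _ _ (\sum_(i < n) c * `|u|))//.
  apply: ler_sum => i _; rewrite linearZ normrZ mulrC ler_pM//.
  exact: normr_coord.
by rewrite sumr_const card_ord -[leRHS]mulrA mulr_natl.
Qed.

Lemma grad_diff (f : 'rV[R]_n -> R) x i : differentiable f x ->
  grad f x i 0 = 'd f x (delta_mx 0 i).
Proof. by move=> df; rewrite mxE deriveE. Qed.

Lemma diff_grad_bound (f : 'rV[R]_n -> R) x (c : R) : differentiable f x ->
  (forall i, `|grad f x i 0| <= c) -> forall u, `|'d f x u| <= n%:R * c * `|u|.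
Proof.
by move=> df fc; apply: linear_rV_bound => i; rewrite -grad_diff.
Qed.

Lemma differentiable_row (V : normedModType R) (f : 'I_n -> V -> R) (x : V) :
  (forall i, differentiable (f i) x) ->
  differentiable (fun y => \row_i f i y) x /\
  forall u, 'd (fun y => \row_i f i y) x u = \row_i 'd (f i) x u.
Proof.
move=> df.
have [K KP] : exists K : R, 0 <= K /\ forall i u, `|'d (f i) x u| <= K * `|u|.
  have h i : exists K : R, 0 < K /\ forall u, `|'d (f i) x u| <= K * `|u|.
    by have [K K0 KP] := differential_bound (df i); exists K.
  have [K KP] := choice h; exists (\sum_i K i); split.
    by apply: sumr_ge0 => i _; apply: ltW; case: (KP i).
  move=> i u; have [_ /(_ u)/le_trans ->//] := KP i.
  rewrite ler_wpM2r// (bigD1 i)//= lerDl; apply: sumr_ge0 => j _.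
  by apply: ltW; case: (KP j).
have [K0 fK] := KP.
have lin : linear (fun u => \row_i 'd (f i) x u).
  by move=> c u v; apply/rowP => i; rewrite !mxE linearP.
have app : approx (fun y => \row_i f i y) x (fun u => \row_i 'd (f i) x u).
  move=> e e0.
  have : \forall y \near x, forall i, `|f i y - f i x - 'd (f i) x (y - x)| <= e * `|y - x|.
    apply: filter_forall => i; exact: differentiable_approx.
  apply: filterS => y h; apply: normr_le_coord; first by rewrite mulr_ge0 ?(ltW e0).
  by move=> i; rewrite !mxE; exact: h.
have bnd u : `|\row_i 'd (f i) x u| <= K * `|u|.
  by apply: normr_le_coord => [|i]; rewrite ?mulr_ge0// mxE.
have [dF dE] := approx_differentiable lin bnd app.
by split => // u; rewrite dE.
Qed.

End coordinates.

Section pairs.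
Context {R : realType} {U V : normedModType R}.

Lemma diff_pair_fst (W : normedModType R) (f : U * V -> W) (x : U) (y : V) u :
  differentiable f (x, y) ->
  differentiable (fun x' => f (x', y)) x /\
  'd (fun x' => f (x', y)) x u = 'd f (x, y) (u, 0).
Proof.
move=> df; have [K K0 fK] := differential_bound df.
have n0 u' : `|(u', 0 : V)| = `|u' : U|.
  by rewrite prod_normE /= normr0; apply/max_idPl.
have [|||d1 e1] := @approx_differentiable _ _ _ (fun x' => f (x', y)) x
    (fun u => 'd f (x, y) (u, 0)) K.
- move=> a u' v'; rewrite -linearP; congr ('d f _ _).
  by apply/pair_equal_spec; rewrite /= scaler0 addr0.
- by move=> u'; rewrite (le_trans (fK _))// n0.
- move=> e e0; have cp : (fun x' => (x', y)) @ x --> (x, y).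
    by apply: cvg_pair; [exact: cvg_id|exact: cvg_cst].
  have := near_along cp (differentiable_approx df e0); apply: filterS => x' /=.
  by rewrite (_ : (x', y) - (x, y) = (x' - x, 0)) ?n0//; apply/pair_equal_spec; rewrite /= subrr.
by split => //; rewrite e1.
Qed.

Lemma diff_pair_snd (W : normedModType R) (f : U * V -> W) (x : U) (y : V) v :
  differentiable f (x, y) ->
  differentiable (fun y' => f (x, y')) y /\
  'd (fun y' => f (x, y')) y v = 'd f (x, y) (0, v).
Proof.
move=> df; have [K K0 fK] := differential_bound df.
have n0 v' : `|(0 : U, v')| = `|v' : V|.
  by rewrite prod_normE /= normr0; apply/max_idPr.
have [|||d1 e1] := @approx_differentiable _ _ _ (fun y' => f (x, y')) y
    (fun v => 'd f (x, y) (0, v)) K.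
- move=> a u' v'; rewrite -linearP; congr ('d f _ _).
  by apply/pair_equal_spec; rewrite /= scaler0 addr0.
- by move=> v'; rewrite (le_trans (fK _))// n0.
- move=> e e0; have cp : (fun y' => (x, y')) @ y --> (x, y).
    by apply: cvg_pair; [exact: cvg_cst|exact: cvg_id].
  have := near_along cp (differentiable_approx df e0); apply: filterS => y' /=.
  by rewrite (_ : (x, y') - (x, y) = (0, y' - y)) ?n0//; apply/pair_equal_spec; rewrite /= subrr.
by split => //; rewrite e1.
Qed.

End pairs.

(** Supplies a state, from which a uniform bound on |g s| is seen to be nonnegative. *)
Lemma probability_inhabited (R : realType) (d : measure_display)
    (T : measurableType d) (m : probability T R) : exists x : T, True.
Proof.
apply: contrapT => h; have := probability_setT m.
rewrite (_ : [set: T] = set0) ?measure0; first by move/eqP; rewrite eq_sym onee_eq0.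
by apply/seteqP; split => x // _; apply: h; exists x.
Qed.

(** * Domination under iterated integrals *)

Section dominated_kernels.
Context {R : realType} {dS dA : measure_display}.
Context {S : measurableType dS} {A : measurableType dA}.

Lemma Rintegral_mul_bound (m : {measure set A -> \bar R}) (k f h : A -> R) (C : R) :
  measurable_fun [set: A] k -> measurable_fun [set: A] f ->
  m.-integrable [set: A] (EFin \o h) ->
  (forall a, `|k a| <= h a) -> (forall a, `|f a| <= C) ->
  m.-integrable [set: A] (fun a => (k a * f a)%:E) /\
  `|\int[m]_a (k a * f a)| <= C * \int[m]_a h a.
Proof.
move=> mk mf ih kh fC.
have ihC : m.-integrable [set: A] (fun a => (C * h a)%:E).
  by rewrite (_ : (fun a => _) = fun a => (C%:E * (EFin \o h) a)%E)//; exact: integrableZl.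
have kf a : `|k a * f a| <= C * h a.
  by rewrite normrM mulrC ler_pM.
have ikf : m.-integrable [set: A] (fun a => (k a * f a)%:E).
  apply: le_integrable ihC => //; first by apply/measurable_EFinP; exact: measurable_funM.
  by move=> a _ /=; rewrite lee_fin (le_trans (kf a))// ler_norm.
split => //; rewrite (le_trans (le_normr_Rintegral _ ikf))// -RintegralZl//.
by apply: le_Rintegral => //; exact: integrable_norm.
Qed.

(** As [h] is uniform in [s], the inner integral is Lipschitz with the constant integral of [h],
    which is integrable for the probability [nu]. Dominated differentiation thus applies twice,
    inside and outside. *)
Lemma nested_dominated_differentiation (V : normedModType R)
    (mu : {sigma_finite_measure set A -> \bar R}) (nu : probability S R)
    (k : V -> S -> A -> R) (x0 : V) (h : A -> R) (C : R) :
  (forall v, measurable_fun [set: S * A] (fun x => k v x.1 x.2)) ->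
  (forall s, mu.-integrable [set: A] (EFin \o k x0 s)) ->
  (forall s, `|\int[mu]_a k x0 s a| <= C) ->
  (forall s a, differentiable (fun v => k v s a) x0) ->
  (forall a, 0 <= h a) -> mu.-integrable [set: A] (EFin \o h) ->
  (\forall v \near x0, forall s a, `|k v s a - k x0 s a| <= h a * `|v - x0|) ->
  differentiable (fun v => \int[nu]_s \int[mu]_a k v s a) x0 /\
  forall u, 'd (fun v => \int[nu]_s \int[mu]_a k v s a) x0 u =
    \int[nu]_s \int[mu]_a 'd (fun v => k v s a) x0 u.
Proof.
move=> mk ik kC dk h0 ih lipk.
have mks v s : measurable_fun [set: A] (k v s).
  exact: (measurableT_comp (mk v) (pair1_measurable s)).
have lipk_s s : \forall v \near x0, forall a, `|k v s a - k x0 s a| <= h a * `|v - x0|.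
  by apply: filterS lipk => v.
have inner s := @dominated_differentiation _ _ _ _ mu (fun v => k v s) x0 h
  (fun v => mks v s) (ik s) (dk s) h0 ih (lipk_s s).
have mouter v : measurable_fun [set: S] (fun s => \int[mu]_a k v s a).
  exact: (measurable_Rintegral_section mu (mk v)).
pose c := \int[mu]_a h a.
have c0 : 0 <= c by apply: Rintegral_ge0.
have lipo : \forall v \near x0, forall s,
    `|\int[mu]_a k v s a - \int[mu]_a k x0 s a| <= c * `|v - x0|.
  apply: filterS lipk => v hv s.
  have ihv : mu.-integrable [set: A] (fun a => (h a * `|v - x0|)%:E).
    rewrite (_ : (fun a => _) = fun a => (`|v - x0|%:E * (EFin \o h) a)%E).
      exact: integrableZl.
    by apply/funext => a; rewrite mulrC EFinM.
  have id1 : mu.-integrable [set: A] (EFin \o (fun a => k v s a - k x0 s a)).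
    apply: le_integrable ihv => //.
      by apply/measurable_EFinP; exact: measurable_funB.
    by move=> a _ /=; rewrite lee_fin (le_trans (hv s a))// ler_norm.
  have ikv : mu.-integrable [set: A] (EFin \o k v s).
    have := integrableD measurableT id1 (ik s); apply: eq_integrable => // a _.
    by rewrite /= -EFinD subrK.
  rewrite -RintegralB// (le_trans (le_normr_Rintegral _ id1))//.
  by rewrite -RintegralZr//; apply: le_Rintegral => //; exact: integrable_norm.
have bk : bmeas (fun s => \int[mu]_a k x0 s a) by split => //; exists C.
have [d1 e1] := @dominated_differentiation _ _ _ _ nu
  (fun v s => \int[mu]_a k v s a) x0 (cst c) mouter (bmeas_integrable nu bk)
  (fun s => (inner s).1) (fun=> c0) (finite_measure_integrable_cst nu c measurableT) lipo.
split; first exact: d1.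
move=> u.
transitivity (\int[nu]_s 'd (fun v => \int[mu]_a k v s a) x0 u).
  exact: e1.
apply: eq_Rintegral => s _.
exact: (inner s).2.
Qed.

End dominated_kernels.

(** * Policy gradient, with its consequences for Q and the visitation *)

Section smooth_policy_family.
Context {R : realType} {dS dA : measure_display}.
Context {S : measurableType dS} {A : measurableType dA}.
Variables (mu : {sigma_finite_measure set A -> \bar R}) (n : nat).
Variables (pi : 'rV[R]_n -> S -> A -> R).
Hypotheses (hpi : forall theta, is_policy mu (pi theta)) (spi : smooth_policies mu pi).

Local Notation V := 'rV[R]_n.

Let dpi theta s a : differentiable (fun t => pi t s a) theta.
Proof. by case: spi. Qed.

Let dgrad theta s a i : differentiable (fun t => grad (fun t' => pi t' s a) t i 0) theta.
Proof. by case: spi => _ []. Qed.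

Let mpi theta : measurable_fun [set: S * A] (fun x => pi theta x.1 x.2).
Proof. by case: (hpi theta). Qed.

Lemma measurable_grad_policy theta i :
  measurable_fun [set: S * A] (fun x => grad (fun t => pi t x.1 x.2) theta i 0).
Proof.
rewrite (_ : (fun x => _) =
    fun x => 'd (fun t => pi t x.1 x.2) theta (delta_mx 0 i)); last first.
  by apply/funext => x; rewrite grad_diff.
exact: (measurable_differential (F := fun t x => pi t x.1 x.2) mpi (fun x => dpi theta x.1 x.2)).
Qed.

Lemma smooth_policies_dominated theta0 : exists h : A -> R,
  [/\ forall a, 0 <= h a, mu.-integrable [set: A] (EFin \o h) &
    \forall theta \near theta0, forall s a,
      [/\ `|pi theta s a - pi theta0 s a| <= h a * `|theta - theta0|,
        forall i, `|grad (fun t => pi t s a) theta i 0| <= h a &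
        forall i, `|grad (fun t => pi t s a) theta i 0
                    - grad (fun t => pi t s a) theta0 i 0|
                  <= h a * `|theta - theta0|] ].
Proof.
have [_ [_ /(_ theta0) [h [ih /nbhs_ballP[r /= r0 hr]]]]] := spi.
have h0 s a : 0 <= n%:R * `|h a| + `|h a| by rewrite addr_ge0// mulr_ge0.
(* The mean value estimate sums [n] partial derivatives, each at most |h a|; the last |h a| is for
   the gradient itself. *)
exists (fun a => n%:R * `|h a| + `|h a|); split.
- by move=> a; rewrite addr_ge0// mulr_ge0.
- have i1 := integrable_norm ih.
  have := integrableD measurableT (integrableZl measurableT n%:R i1) i1.
  by apply: eq_integrable => // a _; rewrite /= -EFinM -EFinD.
apply/nbhs_ballP; exists r => // theta htheta s a.
have le1 (c : R) (u : V) : c <= n%:R * `|h a| -> c * `|u| <= (n%:R * `|h a| + `|h a|) * `|u|.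
  by move=> hc; rewrite ler_wpM2r// (le_trans hc)// lerDl.
split.
- apply: (@le_trans _ _ (n%:R * `|h a| * `|theta - theta0|)); last exact: le1.
  apply: (@lipschitz_of_differential _ _ (fun t => pi t s a) theta0 r) => // y u hy.
  apply: diff_grad_bound => // i; have [g1 _] := hr _ hy s a.
  by rewrite (le_trans (g1 i))// ler_norm.
- move=> i; have [g1 _] := hr _ htheta s a.
  by rewrite (le_trans (g1 i))// (le_trans (ler_norm _))// lerDr mulr_ge0.
- move=> i; apply: (@le_trans _ _ (n%:R * `|h a| * `|theta - theta0|)); last exact: le1.
  apply: (@lipschitz_of_differential _ _ (fun t => grad (fun t' => pi t' s a) t i 0) theta0 r)
    => // y u hy.
  apply: diff_grad_bound => // j; have [_ g2] := hr _ hy s a.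
  have := g2 i j; rewrite !mxE => /le_trans; apply; exact: ler_norm.
Qed.

(** The neighbourhood and [K] come before [M]: they depend on the policies only, the process
    entering through its discount and [value_bound]. This uniformity serves all the auxiliary
    processes. *)
Lemma performance_lipschitz theta0 : exists2 K : R, 0 <= K &
  \forall theta \near theta0, forall M : mdp R S A,
    (1 - discount M) * `|performance mu M (pi theta) - performance mu M (pi theta0)|
    <= K * value_bound M * `|theta - theta0|.
Proof.
have [h [h0 ih hh]] := smooth_policies_dominated theta0.
exists (\int[mu]_a h a); first exact: Rintegral_ge0.
apply: filterS hh => theta hh M.
have g0 : 0 <= 1 - discount M by rewrite subr_ge0 ltW// discount_lt1.
rewrite -[X in X * _](ger0_norm g0) -normrM.
rewrite (performance_difference M (hpi theta0) (hpi theta)).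
have ihv : mu.-integrable [set: A] (EFin \o (fun a => h a * `|theta - theta0|)).
  rewrite (_ : _ \o _ = fun a => (`|theta - theta0|%:E * (EFin \o h) a)%E).
    exact: integrableZl.
  by apply/funext => a; rewrite /= mulrC EFinM.
have mdiff : measurable_fun [set: S * A] (fun x => pi theta x.1 x.2 - pi theta0 x.1 x.2).
  exact: measurable_funB.
have mQ := measurable_qvalue M (hpi theta).
have bound s : `|\int[mu]_a ((pi theta s a - pi theta0 s a) * qvalue mu M (pi theta) s a)|
    <= \int[mu]_a h a * value_bound M * `|theta - theta0|.
  have [_ /le_trans] := @Rintegral_mul_bound _ _ _ mu (fun a => pi theta s a - pi theta0 s a)
    (qvalue mu M (pi theta) s) (fun a => h a * `|theta - theta0|) (value_bound M)
    (measurableT_comp mdiff (pair1_measurable s)) (measurableT_comp mQ (pair1_measurable s))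
    ihv (fun a => let: And3 h1 _ _ := hh s a in h1) (fun a => qvalue_norm M s a (hpi theta)).
  apply; rewrite RintegralZr//.
  by rewrite mulrA [value_bound M * _]mulrC.
apply: Rintegral_probability_bound => //.
apply: (measurable_Rintegral_section mu
  (g := fun x => (pi theta x.1 x.2 - pi theta0 x.1 x.2) * qvalue mu M (pi theta) x.1 x.2)).
exact: measurable_funM.
Qed.

(** Each pair (s, a) has its own auxiliary process, started from the law of its next state. All
    share the discount and the reward bound, so the estimate is uniform in (s, a). *)
Lemma qvalue_lipschitz (M : mdp R S A) theta0 : exists2 K : R, 0 <= K &
  \forall theta \near theta0, forall s a,
    `|qvalue mu M (pi theta) s a - qvalue mu M (pi theta0) s a| <= K * `|theta - theta0|.
Proof.
have [K K0 hK] := performance_lipschitz theta0.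
have g1 : 0 < 1 - discount M by rewrite subr_gt0 discount_lt1.
have v0 : 0 <= value_bound M by rewrite divr_ge0// ltW.
exists (K * value_bound M / (1 - discount M)).
  by rewrite divr_ge0 ?(ltW g1)// mulr_ge0.
apply: filterS hK => theta hK s a.
rewrite !qvalue_performance// opprD addrACA subrr add0r -mulrBr normrM.
rewrite ger0_norm; last by rewrite ltW// discount_gt0.
have := hK (with_init M (trans_prob M (s, a))).
rewrite -ler_pdivlMl// => /(ler_wpM2l (ltW (discount_gt0 M)))/le_trans; apply.
rewrite [leRHS]mulrAC [leRHS]mulrC ler_piMl//.
  by rewrite mulr_ge0 ?invr_ge0 ?(ltW g1)// mulr_ge0// mulr_ge0.
by rewrite ltW// discount_lt1.
Qed.

Section policy_gradient.
Variable M : mdp R S A.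
Variable theta0 : V.
Local Notation nu := (visitation_prob M (hpi theta0)).
Local Notation Q := (qvalue mu M (pi theta0)).

Lemma policy_gradient :
  differentiable (fun theta => performance mu M (pi theta)) theta0 /\
  forall u, 'd (fun theta => performance mu M (pi theta)) theta0 u =
    (1 - discount M)^-1 *
    \int[nu]_s \int[mu]_a 'd (fun theta => pi theta s a * Q s a) theta0 u.
Proof.
have [h [h0 ih hh]] := smooth_policies_dominated theta0.
have [K K0 hK] := qvalue_lipschitz M theta0.
have g1 : 0 < 1 - discount M by rewrite subr_gt0 discount_lt1.
have v0 : 0 <= value_bound M by rewrite divr_ge0// ltW.
have mQ theta := measurable_qvalue M (hpi theta).
have [] := @nested_dominated_differentiation _ _ _ _ _ V mu nu
  (fun theta s a => pi theta s a * Q s a) theta0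
  (fun a => h a * value_bound M) (value_bound M).
- by move=> theta; exact: measurable_funM.
- by move=> s; apply: integrable_mulb; [exact: policy_integrable|exact: bmeas_qvalue].
- move=> s; apply: policy_average_bound => //; first exact: bmeas_qvalue.
  by move=> a; exact: qvalue_norm.
- by move=> s a; exact: differentiableM.
- by move=> a; rewrite mulr_ge0.
- rewrite (_ : _ \o _ = fun a => ((value_bound M)%:E * (EFin \o h) a)%E).
    exact: integrableZl.
  by apply/funext => a; rewrite /= mulrC EFinM.
- apply: filterS hh => theta hh s a; have [h1 _ _] := hh s a.
  by rewrite -mulrBl normrM mulrAC ler_pM// qvalue_norm.
set Phi := (fun v => \int[nu]_s _) => dPhi ePhi.
have dg : differentiable ((1 - discount M)^-1 \*: Phi) theta0 by exact: differentiableZ.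
pose c := \int[mu]_a h a.
have c0 : 0 <= c by apply: Rintegral_ge0.
have [] := @differentiable_quadratic _ _ _
  (fun theta => performance mu M (pi theta)) ((1 - discount M)^-1 \*: Phi) theta0
  ((1 - discount M)^-1 * (K * c)) dg.
  apply: filterS2 hh hK => theta hh hK.
  have mdiff : measurable_fun [set: S * A] (fun x => pi theta x.1 x.2 - pi theta0 x.1 x.2).
    exact: measurable_funB.
  have ihv : mu.-integrable [set: A] (EFin \o (fun a => h a * `|theta - theta0|)).
    rewrite (_ : _ \o _ = fun a => (`|theta - theta0|%:E * (EFin \o h) a)%E).
      exact: integrableZl.
    by apply/funext => a; rewrite /= mulrC EFinM.
  pose w q s := \int[mu]_a ((pi theta s a - pi theta0 s a) * qvalue mu M (pi q) s a).
  have wP q s := @Rintegral_mul_bound _ _ _ mu (fun a => pi theta s a - pi theta0 s a)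
    (qvalue mu M (pi q) s) (fun a => h a * `|theta - theta0|) (value_bound M)
    (measurableT_comp mdiff (pair1_measurable s))
    (measurableT_comp (mQ q) (pair1_measurable s))
    ihv (fun a => let: And3 h1 _ _ := hh s a in h1) (fun a => qvalue_norm M s a (hpi q)).
  have bw q : bmeas (w q).
    apply: (bmeas_kernel_average mdiff (mQ q)) => s; exact: (wP q s).2.
  have eJ : performance mu M (pi theta) - performance mu M (pi theta0) =
      (1 - discount M)^-1 * \int[nu]_s w theta s.
    rewrite -(performance_difference M (hpi theta0) (hpi theta)).
    by rewrite mulrA mulVf ?gt_eqF// mul1r.
  have bp q : bmeas (fun s => \int[mu]_a (pi q s a * Q s a)).
    apply: (bmeas_policy_average (hpi q) (mQ theta0)) => s a; exact: qvalue_norm.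
  have eP : Phi theta - Phi theta0 = \int[nu]_s w theta0 s.
    rewrite /Phi -RintegralB//; [|exact: bmeas_integrable..].
    apply: eq_Rintegral => s _.
    have iq q : mu.-integrable [set: A] (fun a => (pi q s a * Q s a)%:E).
      by apply: integrable_mulb; [exact: policy_integrable|exact: bmeas_qvalue].
    rewrite -RintegralB//; [|exact: iq..].
    by apply: eq_Rintegral => a _; rewrite mulrBl.
  have alg (b j j0 f f0 x y : R) : j - j0 = b * x -> f - f0 = y ->
      `|j - j0 - (b * f - b * f0)| = `|b * (x - y)|.
    by move=> -> <-; rewrite !mulrBr.
  apply: (@le_trans _ _ `|(1 - discount M)^-1 *
      (\int[nu]_s w theta s - \int[nu]_s w theta0 s)|).
    rewrite le_eqVlt; apply/orP; left; apply/eqP.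
    exact: (alg _ _ _ _ _ _ _ eJ eP).
  rewrite normrM [`|_^-1|]gtr0_norm ?invr_gt0// -[leRHS]mulrA.
  apply: ler_wpM2l; first by rewrite invr_ge0 ltW.
  rewrite -RintegralB//; [|exact: bmeas_integrable..].
  apply: Rintegral_probability_bound => [|s].
    by apply: measurable_funB; [exact: (bw theta).1|exact: (bw theta0).1].
  rewrite -RintegralB//; [|exact: (wP theta s).1|exact: (wP theta0 s).1].
  rewrite (_ : \int[mu]_a _ = \int[mu]_a ((pi theta s a - pi theta0 s a) *
      (qvalue mu M (pi theta) s a - Q s a))); last first.
    by apply: eq_Rintegral => a _; rewrite mulrBr.
  have [_ /le_trans] := @Rintegral_mul_bound _ _ _ mu (fun a => pi theta s a - pi theta0 s a)
    (fun a => qvalue mu M (pi theta) s a - Q s a) (fun a => h a * `|theta - theta0|)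
    (K * `|theta - theta0|)
    (measurableT_comp mdiff (pair1_measurable s))
    (measurable_funB (measurableT_comp (mQ theta) (pair1_measurable s))
      (measurableT_comp (mQ theta0) (pair1_measurable s)))
    ihv (fun a => let: And3 h1 _ _ := hh s a in h1) (fun a => hK s a).
  apply; rewrite RintegralZr//.
  by rewrite mulrACA -expr2.
move=> dJ eJ; split; first exact: dJ.
move=> u; rewrite eJ diffZ; last exact: dPhi.
by congr (_ * _); exact: ePhi.
Qed.

End policy_gradient.

Lemma differentiable_qvalue (M : mdp R S A) theta0 s a :
  differentiable (fun theta => qvalue mu M (pi theta) s a) theta0.
Proof.
have [dJ _] := policy_gradient (with_init M (trans_prob M (s, a))) theta0.
rewrite (_ : (fun theta => _) = fun theta => fine (mean_reward M (s, a)) +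
    discount M * performance mu (with_init M (trans_prob M (s, a))) (pi theta)).
  apply: differentiableD; first exact: differentiable_cst.
  exact: (differentiableZ (discount M) dJ).
by apply/funext => theta; rewrite qvalue_performance.
Qed.

Section visitation_average.
Variables (M : mdp R S A) (theta0 : V).

Lemma visitation_average_performance (g : S -> R) (C : R) (mg : measurable_fun [set: S] g)
    (gC : forall s, `|g s| <= C) theta :
  expect_s (visitation mu M (pi theta)) g =
  (1 - discount M) * performance mu (with_state_reward M mg gC) (pi theta) - C.
Proof.
by rewrite (expect_s_visitation M (hpi theta)) performance_state_reward addrK.
Qed.

Lemma visitation_average_differentiable (g : S -> R) : bmeas g ->
  differentiable (fun theta => expect_s (visitation mu M (pi theta)) g) theta0.
Proof.
move=> [mg [C gC]].
rewrite (_ : (fun theta => _) = fun theta =>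
    (1 - discount M) * performance mu (with_state_reward M mg gC) (pi theta) - C).
  apply: differentiableB; last exact: differentiable_cst.
  apply: (differentiableZ (1 - discount M)).
  by have [] := policy_gradient (with_state_reward M mg gC) theta0.
by apply/funext => theta; exact: visitation_average_performance.
Qed.

(** [g] and [C] come after the neighbourhood because the test function will itself move with the
    parameter. *)
Lemma visitation_average_lipschitz : exists2 K : R, 0 <= K &
  \forall theta \near theta0, forall (g : S -> R) (C : R), measurable_fun [set: S] g ->
    (forall s, `|g s| <= C) ->
    `|expect_s (visitation mu M (pi theta)) g -
      expect_s (visitation mu M (pi theta0)) g| <= K * C * `|theta - theta0|.
Proof.
have [K K0 hK] := performance_lipschitz theta0.
have g1 : 0 < 1 - discount M by rewrite subr_gt0 discount_lt1.
(* The auxiliary reward is bounded by 2 C, so its [value_bound] is 2 C / (1 - gamma). *)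
exists (K * 2 / (1 - discount M)); first by rewrite divr_ge0 ?(ltW g1)// mulr_ge0.
have [s0 _] := probability_inhabited (init M).
apply: filterS hK => theta hK g C mg gC.
have C0 : 0 <= C by exact: le_trans (gC s0).
have alg (b x y z w : R) : z = b * x - C -> w = b * y - C -> z - w = b * (x - y).
  by move=> -> ->; ring.
have e := alg _ _ _ _ _ (visitation_average_performance mg gC theta)
  (visitation_average_performance mg gC theta0).
rewrite e normrM (ger0_norm (ltW g1)).
have := hK (with_state_reward M mg gC); move=> /le_trans; apply.
rewrite ler_wpM2r// /value_bound /= ger0_norm ?mulr_ge0//.
by rewrite !mulrA [leRHS]mulrAC.
Qed.

End visitation_average.

End smooth_policy_family.

(** * Differentials of products and of functions of one component *)

Section differential_products.
Context {R : realType}.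

Lemma diff_mul (V : normedModType R) (f g : V -> R) (x u : V) :
  differentiable f x -> differentiable g x ->
  differentiable (fun v => f v * g v) x /\
  'd (fun v => f v * g v) x u = f x * 'd g x u + g x * 'd f x u.
Proof.
move=> df dg; split; first exact: (differentiableM df dg).
by have := diffM df dg; move/(congr1 (fun h : V -> R => h u)).
Qed.

Lemma diff_mul_cst (V : normedModType R) (f : V -> R) (c : R) (x u : V) :
  differentiable f x ->
  differentiable (fun v => f v * c) x /\ 'd (fun v => f v * c) x u = 'd f x u * c.
Proof.
move=> df; have [d e] := @diff_mul V f (cst c) x u df (differentiable_cst c x).
by split; [exact: d | rewrite e diff_cst mulr0 add0r mulrC].
Qed.

Lemma diff_sub_scale (V : normedModType R) (f g : V -> R) (c : R) (x : V) :
  differentiable f x -> differentiable g x ->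
  differentiable (fun v => f v - c * g v) x /\
  forall u, 'd (fun v => f v - c * g v) x u = 'd f x u - c * 'd g x u.
Proof.
move=> df dg; have dcg := differentiableZ c dg.
split; first exact: (differentiableB df dcg).
move=> u; apply: (etrans (congr1 (fun h : V -> R => h u) (diffB df dcg))).
apply: (congr1 (fun z => 'd f x u - z)).
exact: (congr1 (fun h : V -> R => h u) (diffZ c dg)).
Qed.

Context {U V W : normedModType R}.

Lemma diff_comp_fst (f : U -> W) (y u : U * V) : differentiable f y.1 ->
  differentiable (fun z : U * V => f z.1) y /\
  'd (fun z : U * V => f z.1) y u = 'd f (y.1) (u.1).
Proof.
move=> df; have [K K0 fK] := differential_bound df.
have n1 (z : U * V) : `|z.1| <= `|z| by rewrite [leRHS]prod_normE le_max lexx.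
have [|||d1 e1] := @approx_differentiable _ _ _ (fun z : U * V => f z.1) y
    (fun u => 'd f (y.1) (u.1)) K.
- by move=> a u' v'; rewrite linearP.
- by move=> u'; rewrite (le_trans (fK _))// ler_wpM2l ?(ltW K0).
- move=> e e0; have cp : (fun z : U * V => z.1) @ y --> y.1 by exact: cvg_fst.
  have := near_along cp (differentiable_approx df e0); apply: filterS => z /= h.
  by rewrite (le_trans h)// ler_wpM2l ?(ltW e0)// (n1 (z - y)).
by split => //; rewrite e1.
Qed.

Lemma diff_comp_snd (f : V -> W) (y u : U * V) : differentiable f y.2 ->
  differentiable (fun z : U * V => f z.2) y /\
  'd (fun z : U * V => f z.2) y u = 'd f (y.2) (u.2).
Proof.
move=> df; have [K K0 fK] := differential_bound df.
have n1 (z : U * V) : `|z.2| <= `|z| by rewrite [leRHS]prod_normE le_max lexx orbT.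
have [|||d1 e1] := @approx_differentiable _ _ _ (fun z : U * V => f z.2) y
    (fun u => 'd f (y.2) (u.2)) K.
- by move=> a u' v'; rewrite linearP.
- by move=> u'; rewrite (le_trans (fK _))// ler_wpM2l ?(ltW K0).
- move=> e e0; have cp : (fun z : U * V => z.2) @ y --> y.2 by exact: cvg_snd.
  have := near_along cp (differentiable_approx df e0); apply: filterS => z /= h.
  by rewrite (le_trans h)// ler_wpM2l ?(ltW e0)// (n1 (z - y)).
by split => //; rewrite e1.
Qed.

End differential_products.

Lemma measurable_fun_inv_gt0 (R : realType) (d : measure_display)
    (T : measurableType d) (f : T -> R) : (forall x, 0 < f x) ->
  measurable_fun [set: T] f -> measurable_fun [set: T] (fun x => (f x)^-1).
Proof.
move=> f0 mf; rewrite (_ : (fun x => _) = fun x => expR (- ln (f x))).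
  apply: measurableT_comp => //; apply: measurable_funN.
  by apply: measurableT_comp => //; exact: measurable_ln.
by apply/funext => x; rewrite expRN lnK// posrE.
Qed.

(** * Stationarity of the adaptation problem *)

Section adaptation.
Context {R : realType} {dS dA : measure_display}.
Context {S : measurableType dS} {A : measurableType dA}.
Variables (mu : {sigma_finite_measure set A -> \bar R}) (M : mdp R S A) (n : nat).
Variables (pi : 'rV[R]_n -> S -> A -> R) (d : S -> 'rV[R]_n -> 'rV[R]_n -> R).
Variable (lambda : R).
Hypotheses (hpi : forall theta, is_policy mu (pi theta)) (spi : smooth_policies mu pi)
  (sd : smooth_sqdistance d) (hlambda : 0 < lambda).

Local Notation V := 'rV[R]_n.
Local Notation nu f := (visitation_prob M (hpi f)).
Local Notation Q f s a := (qvalue mu M (pi f) s a).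
Local Notation gpi theta i s a := (grad (fun t => pi t s a) theta i 0).
Local Notation gd y i s := (grad (fun t => d s y.1 t ^+ 2) y.2 i 0).

Let dpi theta s a : differentiable (fun t => pi t s a) theta.
Proof. by case: spi. Qed.

Let dgpi theta s a i : differentiable (fun t => gpi t i s a) theta.
Proof. by case: spi => _ []. Qed.

Let mpi theta : measurable_fun [set: S * A] (fun x => pi theta x.1 x.2).
Proof. by case: (hpi theta). Qed.

Let mQ f : measurable_fun [set: S * A] (fun x => Q f x.1 x.2).
Proof. exact: measurable_qvalue. Qed.

Let mgpi theta i : measurable_fun [set: S * A] (fun x => gpi theta i x.1 x.2).
Proof. exact: (measurable_grad_policy hpi spi). Qed.

Let mpiV theta : measurable_fun [set: S * A] (fun x => (pi theta x.1 x.2)^-1).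
Proof.
by apply: measurable_fun_inv_gt0 => // x; have [_ p0 _] := hpi theta.
Qed.

Let section1 (f : S -> A -> R) s : measurable_fun [set: S * A] (fun x => f x.1 x.2) ->
  measurable_fun [set: A] (f s).
Proof. by move=> mf; exact: (measurableT_comp mf (pair1_measurable s)). Qed.

Let dd2 s f theta : differentiable (fun t => d s f t ^+ 2) theta.
Proof. by case: sd => _ []. Qed.

Let dgd s i y : differentiable (fun y : V * V => gd y i s) y.
Proof. by case: sd => _ [_ []]. Qed.

Let md2 f theta : measurable_fun [set: S] (fun s => d s f theta ^+ 2).
Proof. by case: sd. Qed.

Let mgd y i : measurable_fun [set: S] (fun s => gd y i s).
Proof.
rewrite (_ : (fun s => _) =
    fun s => 'd (fun t => d s y.1 t ^+ 2) (y.2) (delta_mx 0 i)); last first.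
  by apply/funext => s; rewrite grad_diff.
exact: (measurable_differential (F := fun t s => d s y.1 t ^+ 2) (md2 y.1)
  (fun s => dd2 s y.1 y.2)).
Qed.

Let sqdistance_bound (x0 : V * V) : exists C r : R, [/\ 0 <= C, 0 < r &
  forall x, ball x0 r x -> forall s, [/\ `|d s x.1 x.2 ^+ 2| <= C,
    forall i, `|gd x i s| <= C,
    forall i u, `|'d (fun y : V * V => gd y i s) x u| <= n%:R * C * 2 * `|u| &
    forall u, `|'d (fun t => d s x.1 t ^+ 2) (x.2) u| <= n%:R * C * `|u|]].
Proof.
have [_ [_ [_ /(_ x0) [C /nbhs_ballP[r /= r0 hr]]]]] := sd.
exists `|C|, r; split => // -[x1 x2] hx s; have [h1 [h2 [h3 h4]]] := hr _ hx s.
rewrite /= in h1 h2 h3 h4 *; have C1 := ler_norm C.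
split.
- by rewrite ger0_norm ?sqr_ge0// (le_trans h1).
- by move=> i; rewrite (le_trans (h2 i)).
- move=> i u.
  (* The total differential splits into its two partial ones, controlled by [mixed_hess] and [hess];
     hence the factor 2. *)
  have e1 : (u.1, 0) + (0, u.2) = u :> V * V.
    by case: u => a b; apply/pair_equal_spec; rewrite /= addr0 add0r.
  have dy : differentiable (fun y : V * V => gd y i s) (x1, x2) by [].
  have [d1 E1] := diff_pair_fst u.1 dy; have [d2 E2] := diff_pair_snd u.2 dy.
  rewrite -[X in 'd _ _ X]e1 linearD (le_trans (ler_normD _ _))//.
  rewrite [leRHS](_ : _ = n%:R * `|C| * `|u| + n%:R * `|C| * `|u|); last by ring.
  apply: lerD.
  + rewrite -E1 (le_trans (@diff_grad_bound _ _ _ _ `|C| d1 _ _))//.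
      by move=> j; have := h4 i j; rewrite !mxE => /le_trans; apply.
    by rewrite ler_wpM2l ?mulr_ge0// [leRHS]prod_normE le_max lexx.
  + rewrite -E2 (le_trans (@diff_grad_bound _ _ _ _ `|C| d2 _ _))//.
      by move=> j; have := h3 i j; rewrite !mxE => /le_trans; apply.
    by rewrite ler_wpM2l ?mulr_ge0// [leRHS]prod_normE le_max lexx orbT.
- by move=> u; apply: diff_grad_bound => // i; rewrite (le_trans (h2 i)).
Qed.

Let sqdistance_lipschitz (y0 : V * V) i : exists2 K : R, 0 <= K &
  \forall y \near y0, forall s, `|gd y i s - gd y0 i s| <= K * `|y - y0|.
Proof.
have [C [r [C0 r0 hr]]] := sqdistance_bound y0.
exists (n%:R * C * 2); first by rewrite !mulr_ge0.
apply/nbhs_ballP; exists r => // y hy s.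
apply: (@lipschitz_of_differential _ _ (fun y : V * V => gd y i s) y0 r) => // z u hz.
by have [_ _ h _] := hr _ hz s; exact: h.
Qed.

(** The importance ratio cancels against the density of [pi f], so [theta] occurs only in [pi theta]
    and in the distance. *)
Let adapt_objectiveE f theta : adapt_objective mu M pi d lambda f theta =
  \int[nu f]_s \int[mu]_a (pi theta s a * Q f s a) -
  lambda * \int[nu f]_s d s f theta ^+ 2.
Proof.
rewrite /adapt_objective /expect_sa !(expect_s_visitation M (hpi f)).
congr (_ - _); apply: eq_Rintegral => s _.
rewrite (expect_aE (hpi f)).
  apply: eq_Rintegral => a _; have [_ p0 _] := hpi f.
  by rewrite mulrA mulrCA divff ?mulr1// gt_eqF.
apply: (section1 (f := fun s a => pi theta s a / pi f s a * Q f s a)).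
by apply: measurable_funM => //; exact: measurable_funM.
Qed.

Let objective_differential f theta :
  differentiable (adapt_objective mu M pi d lambda f) theta /\
  forall i, 'd (adapt_objective mu M pi d lambda f) theta (delta_mx 0 i) =
    \int[nu f]_s \int[mu]_a (gpi theta i s a * Q f s a) -
    lambda * \int[nu f]_s gd (f, theta) i s.
Proof.
have [h [h0 ih hh]] := smooth_policies_dominated spi theta.
have v0 : 0 <= value_bound M by rewrite divr_ge0// subr_ge0 ltW// discount_lt1.
have [] := @nested_dominated_differentiation _ _ _ _ _ V mu (nu f)
  (fun theta s a => pi theta s a * Q f s a) theta
  (fun a => h a * value_bound M) (value_bound M).
- by move=> t; exact: measurable_funM.
- by move=> s; apply: integrable_mulb; [exact: policy_integrable|exact: bmeas_qvalue].
- move=> s; apply: policy_average_bound => //; first exact: bmeas_qvalue.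
  by move=> a; exact: qvalue_norm.
- by move=> s a; have [] := diff_mul_cst (Q f s a) 0 (dpi theta s a).
- by move=> a; rewrite mulr_ge0.
- rewrite (_ : _ \o _ = fun a => ((value_bound M)%:E * (EFin \o h) a)%E).
    exact: integrableZl.
  by apply/funext => a; rewrite /= mulrC EFinM.
- apply: filterS hh => t hh s a; have [h1 _ _] := hh s a.
  by rewrite -mulrBl normrM mulrAC ler_pM// qvalue_norm.
move=> d1 e1.
have [C [r [C0 r0 hr]]] := sqdistance_bound (f, theta).
have inball t : ball theta r t -> ball ((f, theta) : V * V) r (f, t).
  by move=> ht; split => //; exact: ballxx.
have [d2 e2] := @dominated_differentiation _ V _ _ (nu f) (fun t s => d s f t ^+ 2)
  theta (cst (n%:R * C)) (md2 f)
  (bmeas_integrable (nu f) (conj (md2 f theta) (ex_intro _ C (fun s =>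
     let: And4 h _ _ _ := hr _ (ballxx _ r0) s in h))))
  (fun s => dd2 s f theta) (fun=> mulr_ge0 (ler0n _ _) C0)
  (finite_measure_integrable_cst (nu f) (n%:R * C) measurableT)
  (proj2 (nbhs_ballP _ _) (ex_intro2 _ _ r r0 (fun t ht s =>
    lipschitz_of_differential (fun y _ => dd2 s f y)
      (fun y u hy => let: And4 _ _ _ h := hr _ (inball y hy) s in h u) ht))).
have [d3 e3] := diff_sub_scale lambda d1 d2.
have -> : adapt_objective mu M pi d lambda f = (fun t =>
    \int[nu f]_s \int[mu]_a (pi t s a * Q f s a) -
    lambda * \int[nu f]_s d s f t ^+ 2).
  by apply/funext => t; exact: adapt_objectiveE.
split; first exact: d3.
move=> i; have comb (a b a' b' : R) : a = a' -> b = b' ->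
    a - lambda * b = a' - lambda * b' by move=> -> ->.
apply: (etrans (e3 _)); apply: comb.
  apply: (etrans (e1 _)); apply: eq_Rintegral => s _; apply: eq_Rintegral => a _.
  apply: (etrans (diff_mul_cst (Q f s a) (delta_mx 0 i) (dpi theta s a)).2).
  by congr (_ * _); apply/esym; exact: grad_diff.
apply: (etrans (e2 _)); apply: eq_Rintegral => s _; apply/esym.
exact: (@grad_diff _ _ (fun t => d s f t ^+ 2)).
Qed.

Local Notation kernel i y s a := (gpi y.2 i s a * Q y.1 s a).

(** The bracket of the stationarity condition with the action integrated out: the quotient by the
    policy has cancelled. *)
Definition integrand i (y : V * V) (s : S) : R :=
  gd y i s - lambda^-1 * \int[mu]_a kernel i y s a.

(** The partial derivative of the objective in theta, divided by - lambda; with this normalization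
    its own derivative in theta is the matrix to be inverted. The first component of [y] acts
    through the measure as well as the integrand. *)
Definition stationarity i (y : V * V) : R := \int[nu y.1]_s integrand i y s.

Let mkernel i (y : V * V) : measurable_fun [set: S * A] (fun x => kernel i y x.1 x.2).
Proof. exact: measurable_funM. Qed.

Let v0 : 0 <= value_bound M.
Proof. by rewrite divr_ge0// subr_ge0 ltW// discount_lt1. Qed.

Let kernel_bound i (y : V * V) s :
  mu.-integrable [set: A] (fun a => (kernel i y s a)%:E) /\
  exists2 C : R, 0 <= C & forall s, `|\int[mu]_a kernel i y s a| <= C.
Proof.
have [h [h0 ih /nbhs_singleton hh]] := smooth_policies_dominated spi y.2.
have P s' := Rintegral_mul_bound (section1 (f := fun s a => gpi y.2 i s a) s' (mgpi y.2 i))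
  (section1 s' (mQ y.1)) ih (fun a => let: And3 _ g _ := hh s' a in g i)
  (fun a => qvalue_norm M s' a (hpi y.1)).
split; first exact: (P s).1.
exists (value_bound M * \int[mu]_a h a); last by move=> s'; exact: (P s').2.
by rewrite mulr_ge0// Rintegral_ge0.
Qed.

Let bmeas_kernel i (y : V * V) : bmeas (fun s => \int[mu]_a kernel i y s a).
Proof.
split.
  exact: (measurable_Rintegral_section mu (g := fun x => kernel i y x.1 x.2)).
have [s0 _] := probability_inhabited (init M).
by have [_ [C _ kC]] := kernel_bound i y s0; exists C.
Qed.

Let bmeas_gd i (y : V * V) : bmeas (fun s => gd y i s).
Proof.
split => //; have [C [r [C0 r0 hr]]] := sqdistance_bound y; exists C => s.
by have [_ h _ _] := hr _ (ballxx _ r0) s.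
Qed.

Let bmeas_integrand i (y : V * V) : bmeas (integrand i y).
Proof. by apply: bmeasB; [exact: bmeas_gd | apply: bmeasZ; exact: bmeas_kernel]. Qed.

Let Rintegral_integrand (m : probability S R) i (y : V * V) :
  \int[m]_s integrand i y s =
  \int[m]_s gd y i s - lambda^-1 * \int[m]_s \int[mu]_a kernel i y s a.
Proof.
rewrite /integrand RintegralB//.
- rewrite RintegralZl//; exact: bmeas_integrable.
- exact: bmeas_integrable.
- by apply: bmeas_integrable; apply: bmeasZ; exact: bmeas_kernel.
Qed.

Lemma stationarity_adaptation theta' f i :
  is_adaptation mu M pi d lambda theta' -> stationarity i (f, theta' f) = 0.
Proof.
move=> ad; have [dobj eobj] := objective_differential f (theta' f).
have := differential_at_max (delta_mx 0 i) dobj (ad f).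
move=> /(etrans (esym (eobj i))) e.
rewrite /stationarity Rintegral_integrand.
have {e} -> : \int[nu f]_s \int[mu]_a kernel i (f, theta' f) s a =
    lambda * \int[nu f]_s gd (f, theta' f) i s.
  by apply/eqP; rewrite -subr_eq0; apply/eqP; exact: e.
by rewrite mulrA mulVf ?gt_eqF// mul1r subrr.
Qed.

Let kernel_differentiable i (y : V * V) s a :
  differentiable (fun y : V * V => kernel i y s a) y /\
  forall u, 'd (fun y : V * V => kernel i y s a) y u =
    gpi y.2 i s a * 'd (fun f => Q f s a) (y.1) (u.1) +
    Q y.1 s a * 'd (fun t => gpi t i s a) (y.2) (u.2).
Proof.
have dq := differentiable_qvalue hpi spi M y.1 s a.
have d1 u := @diff_comp_fst _ V V _ (fun f => Q f s a) y u dq.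
have d2 u := @diff_comp_snd _ V V _ (fun t => gpi t i s a) y u (dgpi y.2 s a i).
have d3 u := diff_mul u (d2 0).1 (d1 0).1.
split; first exact: (d3 0).1.
move=> u; apply: (etrans (d3 u).2).
by rewrite (d1 u).2 (d2 u).2.
Qed.

Let kernel_lipschitz i (y0 : V * V) : exists h : A -> R,
  [/\ forall a, 0 <= h a, mu.-integrable [set: A] (EFin \o h) &
    \forall y \near y0, forall s a,
      `|kernel i y s a - kernel i y0 s a| <= h a * `|y - y0|].
Proof.
have [h [h0 ih hh]] := smooth_policies_dominated spi y0.2.
have [K K0 hK] := qvalue_lipschitz hpi spi M y0.1.
have hh0 := nbhs_singleton hh.
exists (fun a => h a * (value_bound M + K)); split.
- by move=> a; rewrite mulr_ge0// addr_ge0.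
- rewrite (_ : _ \o _ = fun a => ((value_bound M + K)%:E * (EFin \o h) a)%E).
    exact: integrableZl.
  by apply/funext => a; rewrite /= mulrC EFinM.
have n1 (y : V * V) : `|y.1| <= `|y| by rewrite [leRHS]prod_normE le_max lexx.
have n2 (y : V * V) : `|y.2| <= `|y| by rewrite [leRHS]prod_normE le_max lexx orbT.
have c1 : (fun y : V * V => y.1) @ y0 --> y0.1 by exact: cvg_fst.
have c2 : (fun y : V * V => y.2) @ y0 --> y0.2 by exact: cvg_snd.
apply: filterS2 (near_along c1 hK) (near_along c2 hh) => y hKy hhy s a.
have [_ _ /(_ i) g1] := hhy s a; have [_ /(_ i) g2 _] := hh0 s a.
have q1 := hKy s a; have q2 := qvalue_norm M s a (hpi y.1).
(* The two terms account for [value_bound M] and [K] in the dominating function. *)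
have alg (x x' q q' : R) : x * q - x' * q' = (x - x') * q + x' * (q - q') by ring.
rewrite alg (le_trans (ler_normD _ _))// !normrM -mulrA mulrDl mulrDr; apply: lerD.
  rewrite [value_bound M * _]mulrC mulrA; apply: ler_pM => //.
  by rewrite (le_trans g1)// ler_wpM2l// (n2 (y - y0)).
apply: ler_pM => //; rewrite (le_trans q1)// ler_wpM2l//.
exact: (n1 (y - y0)).
Qed.

Let integrand_lipschitz i (y0 : V * V) : exists2 K : R, 0 <= K &
  \forall y \near y0, forall s,
    `|integrand i y s - integrand i y0 s| <= K * `|y - y0|.
Proof.
have [h [h0 ih hh]] := kernel_lipschitz i y0.
have [K K0 hK] := sqdistance_lipschitz y0 i.
have l0 : 0 <= lambda^-1 by rewrite invr_ge0 ltW.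
pose c := \int[mu]_a h a; have c0 : 0 <= c by exact: Rintegral_ge0.
exists (K + lambda^-1 * c); first by rewrite addr_ge0// mulr_ge0.
apply: filterS2 hh hK => y hh hK s.
have alg (x x' q q' : R) : x - lambda^-1 * q - (x' - lambda^-1 * q') =
  (x - x') - lambda^-1 * (q - q') by ring.
rewrite /integrand alg (le_trans (ler_normB _ _))// mulrDl; apply: lerD => //.
rewrite normrM ger0_norm// -mulrA; apply: ler_wpM2l => //.
have ik (y : V * V) := (kernel_bound i y s).1.
rewrite -RintegralB//; [|exact: ik..].
have ihv : mu.-integrable [set: A] (EFin \o (fun a => h a * `|y - y0|)).
  rewrite (_ : _ \o _ = fun a => (`|y - y0|%:E * (EFin \o h) a)%E).
    exact: integrableZl.
  by apply/funext => a; rewrite /= mulrC EFinM.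
have ikk : mu.-integrable [set: A] (EFin \o (fun a => kernel i y s a - kernel i y0 s a)).
  exact: (integrableB measurableT (ik y) (ik y0)).
rewrite (le_trans (le_normr_Rintegral _ ikk))// /c -RintegralZr//.
by apply: le_Rintegral => //; exact: integrable_norm.
Qed.

(** [y] moves both the measure and the integrand. [N] moves the measure alone, [T] the integrand
    alone; what is left is the difference of the two measures tested against the increment of the
    integrand, of second order. The first summand of the differential comes from [N]. *)
Lemma stationarity_differentiable i (y0 : V * V) :
  differentiable (stationarity i) y0 /\
  forall u, 'd (stationarity i) y0 u =
    'd (fun f => expect_s (visitation mu M (pi f)) (integrand i y0)) (y0.1) (u.1) +
    (\int[nu y0.1]_s 'd (fun y : V * V => gd y i s) y0 u -
     lambda^-1 * \int[nu y0.1]_s \int[mu]_a 'd (fun y : V * V => kernel i y s a) y0 u).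
Proof.
have [h [h0 ih hh]] := kernel_lipschitz i y0.
have [K K0 hK] := sqdistance_lipschitz y0 i.
have [s0 _] := probability_inhabited (init M).
have [_ [C C0 kC]] := kernel_bound i y0 s0.
have [d1 e1] := @dominated_differentiation _ (V * V)%type _ _ (nu y0.1)
  (fun y s => gd y i s) y0 (cst K) (fun y => mgd y i)
  (bmeas_integrable (nu y0.1) (bmeas_gd i y0)) (fun s => dgd s i y0) (fun=> K0)
  (finite_measure_integrable_cst (nu y0.1) K measurableT) hK.
have [d2 e2] := @nested_dominated_differentiation _ _ _ _ _ (V * V)%type mu (nu y0.1)
  (fun y s a => kernel i y s a) y0 h C (mkernel i) (fun s => (kernel_bound i y0 s).1)
  kC (fun s a => (kernel_differentiable i y0 s a).1) h0 ih hh.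
have [d3 e3] := diff_sub_scale lambda^-1 d1 d2.
have dN := visitation_average_differentiable hpi spi M y0.1 (bmeas_integrand i y0).
have d4 u := @diff_comp_fst _ V V _ _ y0 u dN.
pose N (y : V * V) := expect_s (visitation mu M (pi y.1)) (integrand i y0).
pose T (y : V * V) := \int[nu y0.1]_s gd y i s -
  lambda^-1 * \int[nu y0.1]_s \int[mu]_a kernel i y s a.
have dNT : differentiable (N + T) y0 by exact: (differentiableD (d4 0).1 d3).
have [KG KG0 hKG] := integrand_lipschitz i y0.
have [Kv Kv0 hKv] := visitation_average_lipschitz hpi spi M y0.1.
have c1 : (fun y : V * V => y.1) @ y0 --> y0.1 by exact: cvg_fst.
have [dF eF] : differentiable (stationarity i) y0 /\
    'd (stationarity i) y0 = 'd (N + T) y0 :> (V * V -> R).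
  apply: (@differentiable_quadratic _ _ _ _ _ _ (Kv * KG)) => //.
  apply: filterS2 (near_along c1 hKv) hKG => y hv hG.
  have bG := bmeas_integrand i y; have bG0 := bmeas_integrand i y0.
  have TE z : T z = \int[nu y0.1]_s integrand i z s by rewrite Rintegral_integrand.
  have NE z : N z = \int[nu z.1]_s integrand i y0 s by exact: expect_s_visitation.
  have sub (m : probability S R) : \int[m]_s (integrand i y s - integrand i y0 s) =
      \int[m]_s integrand i y s - \int[m]_s integrand i y0 s.
    by rewrite RintegralB//; exact: bmeas_integrable.
  (* The test function is the increment of the integrand; its bound shrinks with |y - y0|, which the
     uniformity in [C] allows. *)
  have := hv (fun s => integrand i y s - integrand i y0 s) (KG * `|y - y0|)
    (bmeasB bG bG0).1 hG.
  have ev f := etrans (expect_s_visitation M (hpi f)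
    (fun s => integrand i y s - integrand i y0 s)) (sub (nu f)).
  have cg (a b c c' e : R) : a = c -> b = c' -> `|a - b| <= e -> `|c - c'| <= e.
    by move=> -> ->.
  move/(cg _ _ _ _ _ (ev y.1) (ev y0.1)) => hb.
  have alg (a b c c' n1 t n0 t0 : R) : n1 = b -> t = c -> n0 = c' -> t0 = c' ->
      a - c' - ((n1 + t) - (n0 + t0)) = a - b - (c - c').
    by move=> -> -> -> ->; ring.
  have e := alg (stationarity i y) _ _ _ _ _ _ _ (NE y) (TE y) (NE y0) (TE y0).
  apply: (@le_trans _ _ (Kv * (KG * `|y - y0|) * `|y.1 - y0.1|)).
    apply: le_trans hb; rewrite le_eqVlt; apply/orP; left; apply/eqP.
    exact: (congr1 Num.norm e).
  rewrite -!mulrA; apply: ler_wpM2l => //.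
  rewrite expr2 !mulrA ler_wpM2l ?mulr_ge0//.
  by rewrite [leRHS]prod_normE le_max lexx.
split; first exact: dF.
move=> u; rewrite eF.
apply: (etrans (congr1 (fun h : V * V -> R => h u) (diffD (d4 0).1 d3))).
have comb (a b a' b' : R) : a = a' -> b = b' -> a + b = a' + b' by move=> -> ->.
apply: comb; first exact: (d4 u).2.
apply: (etrans (e3 u)).
have comb2 (a b a' b' : R) : a = a' -> b = b' ->
  a - lambda^-1 * b = a' - lambda^-1 * b' by move=> -> ->.
by apply: comb2; [exact: e1 | exact: e2].
Qed.

Let diff_kernel_integrable i (y0 u : V * V) :
  (forall s, mu.-integrable [set: A]
    (EFin \o (fun a => 'd (fun y : V * V => kernel i y s a) y0 u))) /\
  bmeas (fun s => \int[mu]_a 'd (fun y : V * V => kernel i y s a) y0 u).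
Proof.
have [h [h0 ih hh]] := kernel_lipschitz i y0.
have dk s a := (kernel_differentiable i y0 s a).1.
have lip s : \forall y \near y0, forall a,
    `|kernel i y s a - kernel i y0 s a| <= h a * `|y - y0|.
  by apply: filterS hh => y.
have mk s y : measurable_fun [set: A] (fun a => kernel i y s a).
  exact: (section1 (f := fun s a => kernel i y s a) s (mkernel i y)).
have bound s a := @dominated_differential_bound _ _ _ _ (fun y a => kernel i y s a) y0 h
  (dk s) (lip s) u a.
have int s := @dominated_differential_integrable _ _ _ _ mu (fun y a => kernel i y s a) y0 h
  (mk s) (dk s) ih (lip s) u.
split; first exact: int.
split.
  apply: (measurable_Rintegral_section mu
    (g := fun x => 'd (fun y : V * V => kernel i y x.1 x.2) y0 u)).
  exact: (measurable_differential (F := fun y x => kernel i y x.1 x.2) (mkernel i)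
    (fun x => dk x.1 x.2)).
exists (\int[mu]_a h a * `|u|) => s.
rewrite (le_trans (le_normr_Rintegral _ (int s)))// -RintegralZr//.
apply: le_Rintegral => //.
- by apply: integrable_norm; exact: int.
- rewrite (_ : _ \o _ = fun a => (`|u|%:E * (EFin \o h) a)%E).
    exact: integrableZl.
  by apply/funext => a; rewrite /= mulrC EFinM.
Qed.

Let bmeas_diff_gd i (y0 u : V * V) : bmeas (fun s => 'd (fun y : V * V => gd y i s) y0 u).
Proof.
have [K K0 hK] := sqdistance_lipschitz y0 i.
split.
  exact: (measurable_differential (F := fun y s => gd y i s) (fun y => mgd y i)
    (fun s => dgd s i y0)).
exists (K * `|u|) => s.
exact: (@dominated_differential_bound _ _ _ _ (fun y s => gd y i s) y0 (cst K)
  (fun s => dgd s i y0) hK u s).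
Qed.

(** The density of [pi phi] cancels the denominator under [w] and integrates to 1 against [c].
    Measure and action law carry separate parameters because the visitation term differentiates the
    former with the latter held fixed. *)
Lemma expect_sa_shift psi phi (c : S -> R) (w g : S -> A -> R) :
  (forall s, mu.-integrable [set: A] (EFin \o w s)) ->
  (forall s a, g s a = c s - (lambda * pi phi s a)^-1 * w s a) ->
  expect_sa mu (visitation mu M (pi psi)) (pi phi) g =
  expect_s (visitation mu M (pi psi)) (fun s => c s - lambda^-1 * \int[mu]_a w s a).
Proof.
move=> iw gE; rewrite /expect_sa; congr (expect_s _ _); apply/funext => s.
have [mp p0 p1] := hpi phi.
have mw : measurable_fun [set: A] (w s).
  by apply/measurable_EFinP; exact: measurable_int (iw s).
have ip := policy_integrable (hpi phi) s.
rewrite (expect_aE (hpi phi)); last first.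
  rewrite (_ : g s = fun a => c s - lambda^-1 * (pi phi s a)^-1 * w s a); last first.
    by apply/funext => a; rewrite gE invfM.
  apply: measurable_funB => //; apply: measurable_funM => //.
  by apply: measurable_funM => //; exact: (section1 (f := fun s a => (pi phi s a)^-1)).
transitivity (\int[mu]_a (c s * pi phi s a - lambda^-1 * w s a)).
  apply: eq_Rintegral => a _; rewrite gE; field.
  by rewrite !gt_eqF.
rewrite RintegralB//.
- by rewrite !RintegralZl// [X in _ * X](_ : _ = 1) ?mulr1// /Rintegral p1.
- by rewrite (_ : _ \o _ = fun a => ((c s)%:E * (EFin \o pi phi s) a)%E)//; exact: integrableZl.
- by rewrite (_ : _ \o _ = fun a => (lambda^-1%:E * (EFin \o w s) a)%E)//; exact: integrableZl.
Qed.

Let linear_part phi i (y0 u : V * V) :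
  expect_s (visitation mu M (pi phi)) (fun s => 'd (fun y : V * V => gd y i s) y0 u -
    lambda^-1 * \int[mu]_a 'd (fun y : V * V => kernel i y s a) y0 u) =
  \int[nu phi]_s 'd (fun y : V * V => gd y i s) y0 u -
  lambda^-1 * \int[nu phi]_s \int[mu]_a 'd (fun y : V * V => kernel i y s a) y0 u.
Proof.
have [_ bk] := diff_kernel_integrable i y0 u.
rewrite (expect_s_visitation M (hpi phi)) RintegralB//.
- by rewrite RintegralZl//; exact: bmeas_integrable.
- by apply: bmeas_integrable; exact: bmeas_diff_gd.
- by apply: bmeas_integrable; exact: bmeasZ.
Qed.

Let sub_scale_mxE (k l : nat) (X Y : 'M[R]_(k, l)) c i j :
  (X - c *: Y) i j = X i j - c * Y i j.
Proof. by rewrite !mxE. Qed.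

Let scale_mxE (k l : nat) (X : 'M[R]_(k, l)) c i j : (c *: X) i j = c * X i j.
Proof. by rewrite mxE. Qed.

(** The direction (0, e_j) leaves the visitation and Q fixed, so only second derivatives in theta
    survive. *)
Lemma adapt_hess_stationarity phi theta i j :
  adapt_hess mu M pi d lambda phi theta i j =
  'd (stationarity i) (phi, theta) (0, delta_mx 0 j).
Proof.
have [_ e] := stationarity_differentiable i (phi, theta).
have comb (x y w w' v : R) : x = y + w -> y = 0 -> w' = w -> v = w' -> v = x.
  by move=> -> -> -> ->; rewrite add0r.
have lin := linear_part phi i (phi, theta) (0, delta_mx 0 j).
apply: (comb _ _ _ _ _ (e (0, delta_mx 0 j)) _ lin); first exact: linear0.
rewrite /adapt_hess mxE; apply: expect_sa_shift => [s|s a].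
  by have [ik _] := diff_kernel_integrable i (phi, theta) (0, delta_mx 0 j); exact: ik.
have [d1 e1] := diff_pair_snd (delta_mx 0 j) (dgd s i (phi, theta)).
have h1 : hess (fun t => d s phi t ^+ 2) theta i j =
    'd (fun t => grad (fun t => d s phi t ^+ 2) t i 0) theta (delta_mx 0 j).
  by rewrite mxE; apply: deriveE.
have h2 : hess (fun t => pi t s a) theta i j =
    'd (fun t => gpi t i s a) theta (delta_mx 0 j).
  by rewrite mxE; apply: deriveE.
have comb2 (a1 a2 w b z q h h' l : R) : a1 = a2 -> w = b * z + q * h' -> z = 0 ->
    h = h' -> a1 - q / l * h = a2 - l^-1 * w.
  by move=> -> -> -> ->; rewrite mulr0 add0r mulrA [l^-1 * _]mulrC.
apply: (etrans (sub_scale_mxE _ _ _ _ _)).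
apply: (comb2 _ _ _ _ _ _ _ _ _ (etrans h1 e1)
  ((kernel_differentiable i (phi, theta) s a).2 (0, delta_mx 0 j)) _ h2).
exact: linear0.
Qed.

(** The direction (e_j, 0) moves the visitation, Q and the first argument of the distance. The
    hypothesis says exactly that the first contribution is 0, and the gradient of the policy stays
    fixed. *)
Lemma adapt_cross_stationarity phi theta i j :
  visitation_term_vanishes mu M pi d lambda phi theta ->
  adapt_cross mu M pi d lambda phi theta i j =
  'd (stationarity i) (phi, theta) (delta_mx 0 j, 0).
Proof.
move=> vanish; have [_ e] := stationarity_differentiable i (phi, theta).
have dN := visitation_average_differentiable hpi spi M phi (bmeas_integrand i (phi, theta)).
have zero : 'd (fun f => expect_s (visitation mu M (pi f)) (integrand i (phi, theta))) phi
    (delta_mx 0 j) = 0.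
  apply: (etrans (esym (deriveE (delta_mx 0 j) dN))).
  have /matrixP/(_ i j) := vanish; rewrite mxE [RHS]mxE => <-.
  apply: (congr1 (fun f => 'D_(delta_mx 0 j) f phi)).
  apply/funext => psi; rewrite mxE; apply/esym.
  apply: expect_sa_shift => [s|s a]; first exact: (kernel_bound i (phi, theta) s).1.
  have alg (a1 q l g : R) : a1 - q / l * g = a1 - l^-1 * (g * q).
    by rewrite [g * q]mulrC mulrA [l^-1 * q]mulrC.
  exact: (etrans (sub_scale_mxE _ _ _ _ _) (alg _ _ _ _)).
have comb (x y w w' v : R) : x = y + w -> y = 0 -> w' = w -> v = w' -> v = x.
  by move=> -> -> -> ->; rewrite add0r.
have lin := linear_part phi i (phi, theta) (delta_mx 0 j, 0).
apply: (comb _ _ _ _ _ (e (delta_mx 0 j, 0)) zero lin).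
rewrite /adapt_cross mxE; apply: expect_sa_shift => [s|s a].
  by have [ik _] := diff_kernel_integrable i (phi, theta) (delta_mx 0 j, 0); exact: ik.
have [d1 e1] := diff_pair_fst (delta_mx 0 j) (dgd s i (phi, theta)).
have h1 : mixed_hess (fun f t => d s f t ^+ 2) phi theta i j =
    'd (fun f => grad (fun t => d s f t ^+ 2) theta i 0) phi (delta_mx 0 j).
  by rewrite mxE; apply: deriveE.
have h2 : (grad (fun t => pi t s a) theta *m (grad (fun f => Q f s a) phi)^T) i j =
    gpi theta i s a * 'd (fun f => Q f s a) phi (delta_mx 0 j).
  rewrite mxE big_ord1 [X in _ * X]mxE; congr (_ * _).
  exact: grad_diff (differentiable_qvalue hpi spi M phi s a).
have comb2 (a1 a2 w b q h z l : R) : a1 = a2 -> w = b + q * z -> z = 0 ->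
    h = b -> a1 - l * h = a2 - l * w.
  by move=> -> -> -> ->; rewrite mulr0 addr0.
apply: (etrans (sub_scale_mxE _ _ _ _ _)).
apply: (comb2 _ _ _ _ _ _ _ _ (etrans h1 e1)
  ((kernel_differentiable i (phi, theta) s a).2 (delta_mx 0 j, 0)) _ h2).
exact: linear0.
Qed.

(** Multiplying and dividing by the density turns the integral of the gradient of the policy times Q
    into an expectation of the score times Q. *)
Lemma grad_performance theta i :
  'd (fun t => performance mu M (pi t)) theta (delta_mx 0 i) =
  (1 - discount M)^-1 *
  expect_mx mu (visitation mu M (pi theta)) (pi theta)
    (fun s a => (Q theta s a / pi theta s a) *: grad (fun t => pi t s a) theta) i 0.
Proof.
have [_ e] := policy_gradient hpi spi M theta.
rewrite e mxE /expect_sa (expect_s_visitation M (hpi theta)); congr (_ * _).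
apply: eq_Rintegral => s _; rewrite (expect_aE (hpi theta)); last first.
  rewrite (_ : (fun a => _) = fun a => Q theta s a * (pi theta s a)^-1 * gpi theta i s a).
    apply: measurable_funM.
      apply: measurable_funM.
        exact: (section1 (f := fun s a => Q theta s a)).
      exact: (section1 (f := fun s a => (pi theta s a)^-1)).
    exact: (section1 (f := fun s a => gpi theta i s a)).
  by apply/funext => a; exact: scale_mxE.
apply: eq_Rintegral => a _; have [_ p0 _] := hpi theta.
have comb (x g q p v : R) : p != 0 -> x = g * q -> v = q / p * g -> x = p * v.
  by move=> p_neq0 -> ->; field.
apply: (comb _ (gpi theta i s a) (Q theta s a)).
- by rewrite gt_eqF.
- apply: (etrans (diff_mul_cst (Q theta s a) (delta_mx 0 i) (dpi theta s a)).2).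
  by congr (_ * _); apply/esym; exact: grad_diff.
- exact: scale_mxE.
Qed.

End adaptation.

(** * Implicit differentiation and chain rule *)

Theorem proposition2 (R : realType) (dS dA : measure_display)
    (S : measurableType dS) (A : measurableType dA)
    (mu : {sigma_finite_measure set A -> \bar R}) (M : mdp R S A)
    (n : nat) (pi : 'rV[R]_n -> S -> A -> R)
    (d : S -> 'rV[R]_n -> 'rV[R]_n -> R) (lambda : R)
    (theta' : 'rV[R]_n -> 'rV[R]_n) (phi : 'rV[R]_n)
    (hpi : forall theta, is_policy mu (pi theta))
    (spi : smooth_policies mu pi)
    (hd : distance_like d)
    (sd : smooth_sqdistance d)
    (hlambda : 0 < lambda)
    (htheta' : is_adaptation mu M pi d lambda theta')
    (ctheta' : {for phi, continuous theta'})
    (hinv : adapt_hess mu M pi d lambda phi (theta' phi) \in unitmx)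
    (hJ : differentiable (fun f => performance mu M (pi (theta' f))) phi) :
  differentiable theta' phi /\
  (* 'J theta' phi has rows indexed by phi: it is nabla_phi theta' *)
  grad (fun f => performance mu M (pi (theta' f))) phi =
    (1 - discount M)^-1 *: ('J theta' phi *m
      expect_mx mu (visitation mu M (pi (theta' phi))) (pi (theta' phi))
        (fun s a =>
          (qvalue mu M (pi (theta' phi)) s a / pi (theta' phi) s a)
            *: grad (fun t => pi t s a) (theta' phi))) /\
  (visitation_term_vanishes mu M pi d lambda phi (theta' phi) ->
   ('J theta' phi)^T =
     - invmx (adapt_hess mu M pi d lambda phi (theta' phi))
       *m adapt_cross mu M pi d lambda phi (theta' phi)).
Proof.
pose V := 'rV[R]_n; set th := theta' phi; set H := adapt_hess mu M pi d lambda phi th.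
have dF i := stationarity_differentiable M hpi spi sd hlambda i ((phi, th) : V * V).
pose F i := stationarity M d lambda hpi i.
pose G (y : V * V) := \row_i F i y.
have [dG eG] := differentiable_row (fun i => (dF i).1).
(* Parameters are row vectors, so the partial differential in theta acts as v |-> v H^T; its inverse
   is right multiplication by the transpose of [invmx H]. *)
have linB : linear (fun w : V => w *m (invmx H)^T).
  by move=> a u v; rewrite mulmxDl scalemxAl.
pose BL : {linear V -> V} := HB.pack (fun w : V => w *m (invmx H)^T)
  (GRing.isLinear.Build _ _ _ _ _ linB).
have BK := @linear_rV_bound R n V BL (\sum_i `|BL (delta_mx 0 i)|).
have {}BK : forall w : V, `|w *m (invmx H)^T| <=
    n%:R * (\sum_i `|BL (delta_mx 0 i)|) * `|w|.
  by apply: BK => i; rewrite (bigD1 i)//= lerDl sumr_ge0.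
have dF0 i (v : V) : 'd (F i) ((phi, th) : V * V) (0, v) = (v *m H^T) 0 i.
  have linD : linear (fun v : V => 'd (F i) ((phi, th) : V * V) (0, v)).
    move=> a u w; rewrite -linearP; congr ('d _ _ _).
    by apply/pair_equal_spec; rewrite /= scaler0 addr0.
  pose DL : {linear V -> R} := HB.pack
    (fun v : V => 'd (F i) ((phi, th) : V * V) (0, v) : R) (GRing.isLinear.Build _ _ _ _ _ linD).
  apply: (@etrans _ _ (DL v)); first by [].
  rewrite [in LHS](row_sum_delta v) linear_sum mxE; apply: eq_bigr => j _.
  rewrite linearZ mxE; apply: (congr1 (fun z => v 0 j * z)); apply/esym.
  exact: (adapt_hess_stationarity M hpi spi sd hlambda phi th i j).
have BG (v : V) : 'd G (phi, th) (0, v) *m (invmx H)^T = v.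
  have -> : 'd G (phi, th) (0, v) = v *m H^T.
    rewrite eG; apply/rowP => i; rewrite mxE; exact: dF0.
  by rewrite -mulmxA -trmx_mul mulVmx// trmx1 mulmx1.
have G0 f : G (f, theta' f) = 0.
  by apply/rowP => i; rewrite !mxE; exact: stationarity_adaptation.
have [dth eth] := implicit_differentiable (g := theta') dG linB BK BG ctheta' G0.
have dJ t := policy_gradient hpi spi M t.
split; first exact: dth.
split.
- apply/colP => j.
  (* [w] is row [j] of ['J theta' phi]; expanding it in the basis turns the chain rule into the
     matrix product. *)
  pose w := 'd theta' phi (delta_mx 0 j).
  have dJth := differentiable_comp dth (dJ th).1.
  apply: (etrans (grad_diff j dJth)).
  have c := congr1 (fun h : V -> R => h (delta_mx 0 j)) (diff_comp dth (dJ th).1).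
  apply: (etrans c); rewrite /= -/th -/w.
  rewrite [in LHS](row_sum_delta w) linear_sum mxE mxE mulr_sumr.
  apply: eq_bigr => i _; rewrite linearZ mulrCA.
  have -> : 'J theta' phi j i = w 0 i by rewrite mxE.
  apply: (congr1 (fun z => w 0 i * z)).
  exact: (grad_performance M hpi spi th i).
- move=> vanish; apply/matrixP => i j.
  (* Column [j] on the left is the differential at e_j, that is, minus a row times the transpose of
     [invmx H]; entrywise this is minus [invmx H] applied to column [j] of [adapt_cross]. *)
  rewrite mulNmx [RHS]mxE mxE mxE eth [LHS]mxE.
  apply: (congr1 -%R); rewrite !mxE; apply: eq_bigr => k _.
  rewrite [(invmx H)^T _ _]mxE mulrC; apply: (congr1 (fun z => _ * z)).
  rewrite eG mxE; apply/esym.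
  exact: (adapt_cross_stationarity hpi spi sd hlambda k j vanish).
Qed.
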